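(* Let $G=(V,E)$ be a finite simple graph with a fixed total order on $V$, and $\lambda$ a partition. The coefficient of $\overline{p}'_\lambda$ in the $\overline{p}'$-expansion of $\omega(\overline{X}_G)$ equals the number of sets $\{L_1,\dots,L_{\ell(\lambda)}\}$ of $\ell(\lambda)$ pairwise distinct Lyndon heaps on $G$ with $|L_i|=\lambda_i$ (i.e. for each $k$, exactly $i_k(\lambda)$ of them have size $k$) such that every vertex of $G$ is used by at least one $L_i$. Equivalently, it equals $\sum_{W\subseteq V}(-1)^{|V\setminus W|}\prod_{k\ge1}\binom{|\mathcal{L}_{G|_W}(k)|}{i_k(\lambda)}$. In particular $\omega(\overline{X}_G)$ is $\overline{p}'$-positive.
   Context: Graphs finite simple; $G|_W$ induced subgraph; $i_k(\lambda)$ multiplicity of $k$ in $\lambda$. $\overline{X}_G=\sum_\kappa\prod_v\prod_{i\in\kappa(v)}x_i$ over proper set colorings $\kappa$ (nonempty color sets, disjoint on adjacent vertices). $1+\overline{p}'_k=\prod_{i\ge1}\frac1{1-x_i^k}$, $\overline{p}'_\lambda=\prod_i\overline{p}'_{\lambda_i}$. $\omega$ is the standard involution on symmetric functions ($\omega(p_\lambda)=(-1)^{|\lambda|-\ell(\lambda)}p_\lambda$), extended degree-wise to symmetric power series. Heaps: fix a total order on $V$. A heap on $G$ is an equivalence class of finite words over $V$ under swapping adjacent letters $u\neq v$ nonadjacent in $G$; size = length; a vertex is used if it occurs; composition = concatenation. Pieces are partially ordered by the transitive closure of: piece $i\prec$ piece $j$ if $i<j$ and the letters are equal or adjacent. A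 pyramid has a unique minimal piece. Periodic: $H=K^{\circ m}$, $m>1$. Rotation: for a piece $p$ with $V_p$ the heap of pieces $\succeq p$ and $H=U\circ V_p$, $A_p(H)=V_p\circ U$; iterates stabilize at a pyramid $A_p^\infty(H)$ with minimal piece $p$; this defines rotation-equivalence of pyramids; each class is entirely periodic or aperiodic. Standard word = lexicographically maximal representative. A Lyndon heap is an aperiodic pyramid with lexicographically minimal standard word in its rotation class. $\mathcal{L}_G(k)$ = Lyndon heaps of size $k$. *)

(* Defs.v *)
From HB Require Import structures.
From mathcomp Require Import all_boot all_order all_algebra.
Unset Printing Implicit Defensive.
Import Order.TTheory GRing.Theory Num.Theory.

(* Formal power series in the countably many variables x_0, x_1, ...        *)
(* (x_i here corresponds to x_{i+1} in the paper), with rational            *)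
(* coefficients, represented by their coefficient functions: for every N,   *)
(* [F N a] is the coefficient of the monomial x^a = prod_{i<N} x_i^(a i)    *)
(* (exponents of variables >= N being 0).                                   *)

Definition mon (N : nat) := {ffun 'I_N -> nat}.
Definition mdeg {N} (a : mon N) : nat := (\sum_(i < N) a i)%N.
Definition series := forall N : nat, mon N -> rat.

Local Open Scope ring_scope.

Definition smul (F G : series) : series := fun N a =>
  \sum_(b : {ffun 'I_N -> 'I_(mdeg a).+1} | [forall i, (b i <= a i)%N])
     F N [ffun i => val (b i)] * G N [ffun i => (a i - b i)%N].

Definition sone : series := fun N a => if mdeg a == 0%N then 1 else 0.

Definition psum (k : nat) : series := fun N a =>
  if (0 < k)%N && [exists i, [forall j, a j == (if j == i then k else 0%N)]]
  then 1 else 0.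

(* \bar p'_k, defined by 1 + \bar p'_k = prod_i 1/(1 - x_i^k), i.e. the sum of
   all monomials x^(k b) with b a nonzero exponent vector *)
Definition pbar1 (k : nat) : series := fun N a =>
  if (mdeg a != 0%N) && [forall i, (k %| a i)%N] then 1 else 0.

Definition pprod (l : seq nat) : series := foldr (fun k F => smul (psum k) F) sone l.
Definition pbar (l : seq nat) : series := foldr (fun k F => smul (pbar1 k) F) sone l.

Definition is_partition (l : seq nat) : bool :=
  sorted (fun a b => b <= a)%N l && all (fun k => 0 < k)%N l.

Definition partitions (n : nat) : seq (seq nat) :=
  [seq l <- flatten [seq [seq map val (tval t) | t : k.-tuple 'I_n.+1] | k <- iota 0 n.+1]
   | is_partition l && (sumn l == n)].

(* The involution omega, extended degree-wise: [Omega F G] means G = omega(F),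
   i.e. for each degree d the homogeneous component F_d is a linear combination
   sum_l a_l p_l of power sums p_l (l |- d) and G_d = sum_l a_l (-1)^(d - l(l)) p_l. *)
Definition Omega (F G : series) : Prop :=
  forall d : nat, exists (s : seq (seq nat)) (c : seq nat -> rat),
    all (fun l => is_partition l && (sumn l == d)) s /\
    forall N (a : mon N), mdeg a = d ->
      F N a = \sum_(l <- s) c l * pprod l N a /\
      G N a = \sum_(l <- s) c l * (-1) ^+ (d - size l) * pprod l N a.

(* the (formally convergent) expansion sum_l c_l \bar p'_l over all partitions
   l; only partitions with |l| <= deg(a) contribute to the coefficient of x^a *)
Definition pbar_expansion (c : seq nat -> rat) : series := fun N a =>
  \sum_(n < (mdeg a).+1) \sum_(l <- partitions n) c l * pbar l N a.

Section Graph.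
Variables (disp : Order.disp_t) (V : finOrderType disp) (adj : rel V).

Definition proper_set_coloring {N} (kappa : {ffun V -> {set 'I_N}}) : bool :=
  [forall v, kappa v != set0] &&
  [forall u, forall v, adj u v ==> [disjoint kappa u & kappa v]].

Definition XG : series := fun N a =>
  (#|[set kappa : {ffun V -> {set 'I_N}} | proper_set_coloring kappa &&
       [forall i, #|[set v | i \in kappa v]| == a i]]|)%:R.

(* Heaps, represented by words (seq V)                                      *)

Definition swap1 (w w' : seq V) : bool :=
  has (fun i => match drop i w with
                | u :: v :: r => [&& u != v, ~~ adj u v & w' == take i w ++ v :: u :: r]
                | _ => false end) (iota 0 (size w)).

Definition heap_eqb (w w' : seq V) : bool :=
  [exists t : (size w).-tuple V,
     (tval t == w') &&
     connect [rel x y : (size w).-tuple V | swap1 x y] (in_tuple w) t].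

Fixpoint lexle (s t : seq V) : bool :=
  match s, t with
  | [::], _ => true
  | _ :: _, [::] => false
  | x :: s', y :: t' => (Order.lt x y) || ((x == y) && lexle s' t')
  end.

(* generating relation of the order on pieces (= positions of w) *)
Definition prec (w : seq V) (i j : nat) : bool :=
  (i < j)%N && match onth w i, onth w j with
              | Some a, Some b => (a == b) || adj a b
              | _, _ => false end.

Definition below (w : seq V) (i j : 'I_(size w)) : bool :=
  connect [rel x y : 'I_(size w) | prec w x y] i j.

Definition pyramid (w : seq V) : bool :=
  #|[set j : 'I_(size w) | [forall i : 'I_(size w), (i != j) ==> ~~ below w i j]]| == 1%N.

Definition periodic (w : seq V) : bool :=
  [exists m : 'I_(size w).+1, (1 < m)%N &&
     [exists u : (size w %/ m).-tuple V, heap_eqb w (flatten (nseq m (tval u)))]].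

Definition upmask (w : seq V) (i : nat) : bitseq :=
  [seq [exists x : 'I_(size w), (val x == i) && below w x j] | j <- enum 'I_(size w)].

(* rotation A_p with p the piece at position i: H = U o V_p  |->  V_p o U;
   the piece p is then at position 0 *)
Definition rot (w : seq V) (i : nat) : seq V :=
  mask (upmask w i) w ++ mask (map negb (upmask w i)) w.

(* A_p^infty (the iterates stabilize after at most size w steps) *)
Definition Ainf (w : seq V) (i : nat) : seq V :=
  iter (size w) (fun u => rot u 0) (rot w i).

Definition is_std (w : seq V) : bool :=
  [forall t : (size w).-tuple V, heap_eqb w t ==> lexle t w].

(* w is the standard word of a Lyndon heap: an aperiodic pyramid whose standard
   word is lexicographically minimal among the standard words of its rotation
   class {A_p^infty(w) | p a piece of w} *)
Definition lyndon (w : seq V) : bool :=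
  [&& is_std w, pyramid w, ~~ periodic w &
      [forall i : 'I_(size w), forall t : (size w).-tuple V,
          (is_std t && heap_eqb t (Ainf w i)) ==> lexle w t]].

(* L_{G|_W}(k): Lyndon heaps of size k on the induced subgraph G|_W, i.e. heaps
   whose letters all lie in W (represented by their standard words) *)
Definition lyndon_set (W : {set V}) (k : nat) : {set k.-tuple V} :=
  [set t : k.-tuple V | all (fun v => v \in W) t && lyndon t].

Definition heapcount (lam : seq nat) : nat :=
  #|[set S : {set {k : 'I_(sumn lam).+1 & k.-tuple V}} |
     [&& [forall x in S, lyndon (tagged x)],
         #|S| == size lam,
         [forall k : 'I_(sumn lam).+1,
            #|[set x in S | tag x == k]| == count_mem (val k) lam] &
         [forall v : V, [exists x in S, v \in tval (tagged x)]]]]|.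

Definition altsum (lam : seq nat) : int :=
  \sum_(W : {set V}) (-1) ^+ #|~: W| *
     \prod_(1 <= k < (sumn lam).+1) ('C(#|lyndon_set W k|, count_mem k lam))%:Z.

End Graph.

Arguments XG {disp V} adj N a.
Arguments lyndon {disp V} adj w.
Arguments lyndon_set {disp V} adj W k.
Arguments heapcount {disp V} adj lam.
Arguments altsum {disp V} adj lam.

(* Main.v *)
Require Import Defs.
From HB Require Import structures.
From mathcomp Require Import all_boot all_order all_algebra.
Set Implicit Arguments.
Unset Strict Implicit.
Import Order.TTheory GRing.Theory Num.Theory.

(** A standard word (lexicographically maximal in its heap) is one without a factor a u b
   such that a < b and b is neither equal nor adjacent to a letter of a u. Cutting a standard
   word at occurrences of its least letter, and gluing the pieces in another order, preserves this property;
   hence Lyndon heaps are exactly the standard words that are Lyndon words, and the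
   nonincreasing factorization into Lyndon words identifies standard words over W with
   multisets of Lyndon heaps over W. So the series H_W counting heaps over W is the product of
   1/(1 - t^|L|) over Lyndon heaps L, and the product of the H_W(x_i) is the product over L of
   1 + pbar'_|L|, whose expansion has the products of binomials as coefficients.
   On the other side, inclusion-exclusion on the used vertices writes X_G as the signed sum over W of the
   products of I_W(x_i), with I_W counting independent subsets of W. Cartier and Foata's
   identity I_W(-t) H_W(t) = 1 makes the logarithmic derivatives of I_W and H_W agree up to
   the signs by which omega acts on power sums, so omega exchanges the two products. *)

(** The rotation class in the definition of a Lyndon heap consists of heaps and is reached by an
    iterated process. The least letter a tames it. A suffix of a standard word that starts with a is
    already a pyramid, so rotating at an occurrence of a is cyclic rotation of the word, in one
    step; rotating at a piece with another letter gives a pyramid whose standard word starts with a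
    greater letter and cannot compete. Hence only cyclic rotations matter, and aperiodicity turns
    into primitivity of the word. On the other side, [Omega] asks in each degree for one finite
    combination of power sums valid for every number N of variables. The logarithmic derivative
    supplies a recurrence on the degree whose coefficients do not depend on N, and the combination
    is built by induction along it. Cutting at a degree D keeps the list of Lyndon heaps finite. *)

(** * The lexicographic order on words *)

Section Lex.
Variables (disp : Order.disp_t) (V : finOrderType disp).
Implicit Types (s t u : seq V).
Local Notation lexle := (@Defs.lexle disp V).

Lemma lexleE s t : lexle s t = ((s : seqlexi V) <= t)%O.
Proof.
elim: s t => [|x s IH] [|y t] //=; rewrite lexi_cons -IH.
by case: (ltgtP x y) => //= [_|->]; rewrite ?implybT ?eqxx.
Qed.

Lemma lexle_refl s : lexle s s. Proof. by rewrite lexleE. Qed.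

Lemma lexle_trans : transitive lexle.
Proof. by move=> t s u; rewrite !lexleE; apply: le_trans. Qed.

Lemma lexle_anti : antisymmetric lexle.
Proof. by move=> s t; rewrite !lexleE => h; apply: (@le_anti _ (seqlexi V)). Qed.

Lemma lexle_total : total lexle.
Proof. by move=> s t; rewrite !lexleE; apply: le_total. Qed.

Lemma lexle_prefix s t : lexle s (s ++ t).
Proof. by elim: s => //= x s ->; rewrite eqxx orbT. Qed.

Lemma lexle_catl s t u : lexle (s ++ t) (s ++ u) = lexle t u.
Proof. by elim: s => //= x s ->; rewrite ltxx eqxx. Qed.

Lemma lexle_head x y s t : lexle (x :: s) (y :: t) -> (x <= y)%O.
Proof. by case/orP => [/ltW//|/andP[/eqP->]]. Qed.

(** A comparison decided at a differing letter is immune to anything appended on either side; only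
    the prefix case is not. *)
Lemma lexle_prefix_or s t : lexle s t ->
  (exists u, t = s ++ u) \/ (forall u v, lexle (s ++ u) (t ++ v)).
Proof.
elim: s t => [|x s IH] [|y t] //=; [by left; exists [::]|by left; exists (y :: t)|].
case/orP => [xy|/andP[/eqP<- /IH [[u ->]|h]]].
- by right=> u v; rewrite xy.
- by left; exists u.
- by right=> u v; rewrite eqxx h orbT.
Qed.

Lemma lexle_eqsize_catr s t u v : size s = size t ->
  lexle (s ++ u) (t ++ v) -> lexle s t.
Proof.
elim: s t => [|x s IH] [|y t] //= [/IH h].
by case/orP => [->//|/andP[-> /h ->]]; rewrite orbT.
Qed.

End Lex.
#[local] Hint Resolve lexle_refl : core.

Lemma mem_first_split (T : eqType) (y : T) (w : seq T) :
  y \in w -> exists u s, w = u ++ y :: s /\ y \notin u.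
Proof.
elim: w => //= x w IH; rewrite inE; case: eqVneq => [<- _|ne /= /IH [u [s [-> h]]]].
  by exists [::], w.
by exists (x :: u), s; rewrite inE negb_or ne.
Qed.

(** * Heaps and standard words *)

Section Heap.
Variables (disp : Order.disp_t) (V : finOrderType disp) (adj : rel V).
Hypothesis adj_sym : symmetric adj.
Implicit Types (a b c x y : V) (p s t u v w : seq V).
Local Notation swap1 := (@swap1 disp V adj).
Local Notation heap_eqb := (@heap_eqb disp V adj).

Definition linked a b := (a == b) || adj a b.
Definition free b u := all (fun c => ~~ linked b c) u.
Arguments free : simpl never.

(* Equality of heaps, through the projections to pairs of linked letters. *)
Definition heap_eq w w' := [forall a, forall b,
  linked a b ==> (filter (pred2 a b) w == filter (pred2 a b) w')].

Lemma linked_sym : symmetric linked.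
Proof. by move=> a b; rewrite /linked eq_sym adj_sym. Qed.

Lemma linked_refl a : linked a a. Proof. by rewrite /linked eqxx. Qed.

Lemma heap_eqP w w' : reflect
  (forall a b, linked a b -> filter (pred2 a b) w = filter (pred2 a b) w')
  (heap_eq w w').
Proof.
apply: (iffP forallP) => [h a b l|h a].
  by have /forallP/(_ b)/implyP/(_ l)/eqP := h a.
by apply/forallP => b; apply/implyP => /h ->.
Qed.

Lemma heap_eq_refl w : heap_eq w w. Proof. exact/heap_eqP. Qed.
Hint Resolve heap_eq_refl : core.

Lemma heap_eq_sym : symmetric heap_eq.
Proof. by move=> w w'; apply/heap_eqP/heap_eqP => h a b /h. Qed.

Lemma heap_eq_trans : transitive heap_eq.
Proof.
by move=> w' w w'' /heap_eqP h /heap_eqP k; apply/heap_eqP => a b l; rewrite h ?k.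
Qed.

Lemma heap_eq_cat s s' t t' : heap_eq s s' -> heap_eq t t' -> heap_eq (s ++ t) (s' ++ t').
Proof.
move=> /heap_eqP h /heap_eqP k; apply/heap_eqP => a b l.
by rewrite !filter_cat h ?k.
Qed.

Lemma heap_eq_catl s t t' : heap_eq (s ++ t) (s ++ t') = heap_eq t t'.
Proof.
apply/idP/idP => [/heap_eqP h|]; last exact: heap_eq_cat.
apply/heap_eqP => a b /h; rewrite !filter_cat => /(congr1 (drop (size (filter (pred2 a b) s)))).
by rewrite !drop_size_cat.
Qed.

(** The projections to pairs (a, a) record multiplicities; [linked] contains equality for this
    purpose. *)
Lemma heap_eq_perm w w' : heap_eq w w' -> perm_eq w w'.
Proof.
move=> /heap_eqP h; apply/allP => a _ /=; apply/eqP.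
have e s : count_mem a s = size (filter (pred2 a a) s).
  by rewrite size_filter; apply: eq_count => x /=; rewrite orbb.
by rewrite !e h // linked_refl.
Qed.

Lemma heap_eq_size w w' : heap_eq w w' -> size w = size w'.
Proof. by move/heap_eq_perm/perm_size. Qed.

Lemma heap_eq_free b u : free b u -> heap_eq (u ++ [:: b]) (b :: u).
Proof.
move=> /allP f; apply/heap_eqP => c d l; have -> : b :: u = [:: b] ++ u by []; rewrite !filter_cat.
case: (boolP ((b == c) || (b == d))) => [bcd|]; last first.
  by rewrite /= => /negbTE ->; rewrite cats0.
suff -> : [seq x <- u | pred2 c d x] = [::] by rewrite cats0.
apply/eqP; rewrite -[_ == _]negbK -has_filter; apply/hasPn => x /f nl.
apply: contra nl => /= xcd.
by case/orP: bcd => /eqP->; case/orP: xcd => /eqP->; rewrite ?linked_refl // linked_sym.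
Qed.

Lemma heap_eq_move p u b s : free b u -> heap_eq (p ++ u ++ b :: s) (p ++ b :: u ++ s).
Proof.
move=> f; rewrite heap_eq_catl -cat1s catA -cat_cons.
by apply: heap_eq_cat => //; apply: heap_eq_free.
Qed.

(** The factor u stops before the first y. A letter c of x :: u linked to y would put c first in one
    projection to the pair y, c, and y first in the other. *)
Lemma heap_eq_head x y w t : heap_eq (x :: w) (y :: t) -> x != y ->
  exists u s, w = u ++ y :: s /\ free y (x :: u).
Proof.
move=> e ne; have := perm_mem (heap_eq_perm e) y; rewrite !inE eqxx eq_sym (negbTE ne) /=.
case/mem_first_split => u [s [ew yu]]; exists u, s; split=> //.
have {}yu : y \notin x :: u by rewrite inE negb_or yu eq_sym ne.
suff f c : c \in x :: u -> ~~ linked y c by apply/(@allP _ _ (x :: u)).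
move=> cu; apply/negP => l.
have /heap_eqP/(_ _ _ l) := e; rewrite ew -cat_cons filter_cat.
rewrite [X in _ = X]/= eqxx [X in _ = X]/=.
case E: [seq z <- x :: u | pred2 y c z] => [|z r].
  by move/eqP: E; rewrite -[_ == _]negbK -has_filter => /hasPn/(_ _ cu) /=; rewrite eqxx orbT.
case=> ez _; move: yu; rewrite -ez.
by have := mem_head z r; rewrite -E mem_filter => /andP[_ ->].
Qed.

(** Swap sequences on words without a fixed length, so that a common first letter can be added or
    removed; [heap_eqb] fixes the length by its tuples. *)
Inductive swaps : seq V -> seq V -> Prop :=
| swaps0 w : swaps w w
| swapsS w1 w2 w3 : swap1 w1 w2 -> swaps w2 w3 -> swaps w1 w3.

Lemma swap1P w w' : reflect
  (exists p a b s, [/\ a != b, ~~ adj a b, w = p ++ a :: b :: s & w' = p ++ b :: a :: s])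
  (swap1 w w').
Proof.
apply: (iffP hasP) => [[i _]|[p [a [b [s [ne na -> ->]]]]]].
  case E: (drop i w) => [//|u [//|v s]] /and3P[ne na /eqP ->].
  by exists (take i w), u, v, s; split => //; rewrite -E cat_take_drop.
exists (size p); first by rewrite mem_iota size_cat /= add0n -addSnnS leq_addr.
by rewrite drop_size_cat // take_size_cat // ne na eqxx.
Qed.

Lemma swap1_heap_eq w w' : swap1 w w' -> heap_eq w w'.
Proof.
case/swap1P => p [a [b [s [ne na -> ->]]]].
apply: (@heap_eq_move p [:: a]); rewrite /free /= andbT /linked negb_or eq_sym ne.
by rewrite adj_sym na.
Qed.

Lemma swaps_trans w1 w2 w3 : swaps w1 w2 -> swaps w2 w3 -> swaps w1 w3.
Proof. by elim=> // w4 w5 w6 h _ IH /IH; apply: swapsS h. Qed.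

Lemma swaps_cons x w w' : swaps w w' -> swaps (x :: w) (x :: w').
Proof.
elim=> [s|w1 w2 w3 /swap1P[p [a [b [s [ne na -> ->]]]]] _ IH]; first exact: swaps0.
by apply: swapsS IH; apply/swap1P; exists (x :: p), a, b, s.
Qed.

Lemma swaps_move u b s : free b u -> swaps (u ++ b :: s) (b :: u ++ s).
Proof.
elim: u => [|c u IH] /=; first by move=> _; apply: swaps0.
case/andP; rewrite /linked negb_or => /andP[ne na] /IH h.
apply: (swaps_trans (swaps_cons c h)); apply: swapsS (swaps0 _).
by apply/swap1P; exists [::], c, b, (u ++ s); rewrite eq_sym ne adj_sym na.
Qed.

(** The first letter of the target is pulled to the front by swaps and then cancelled from both
    words. *)
Lemma heap_eq_swaps w w' : heap_eq w w' -> swaps w w'.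
Proof.
elim: w' w => [|y t IH] w e.
  by move/heap_eq_size: e => /= /size0nil ->; apply: swaps0.
case: w e => [/heap_eq_size//|x w] e; case: (eqVneq x y) => [xy|ne].
  by move: e; rewrite -xy => e; apply/swaps_cons/IH; rewrite -(heap_eq_catl [:: x]).
have [u [s [ew f]]] := heap_eq_head e ne.
have m : swaps (x :: w) (y :: (x :: u) ++ s) by rewrite ew -cat_cons; apply: swaps_move.
apply: (swaps_trans m); apply/swaps_cons/IH; rewrite -(heap_eq_catl [:: y]).
apply: heap_eq_trans e; rewrite heap_eq_sym ew -cat_cons.
by apply: (@heap_eq_move [::]).
Qed.

Lemma swaps_connect n (s t : n.-tuple V) : swaps s t ->
  connect [rel x y : n.-tuple V | swap1 x y] s t.
Proof.
move Es: (val s) => s'; move Et: (val t) => t' sw.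
elim: sw s t Es Et => [w|w1 w2 w3 s1 _ IH] s t Es Et.
  by have -> : s = t by apply: val_inj; rewrite /= Es Et.
have sz : size w2 == n by rewrite -(heap_eq_size (swap1_heap_eq s1)) -Es size_tuple.
apply: (connect_trans _ (IH (Tuple sz) t erefl Et)).
by apply: connect1; rewrite /= Es.
Qed.

Lemma heap_eqbE w w' : heap_eqb w w' = heap_eq w w'.
Proof.
apply/existsP/idP => [[t /andP[/eqP <- /connectP[p pth ->]]]|e].
  rewrite -[X in heap_eq X]/(tval (in_tuple w)).
  elim: p (in_tuple w) pth => [|r p IH] q //= /andP[/swap1_heap_eq h /IH].
  exact: heap_eq_trans.
have sz : size w' == size w by rewrite (heap_eq_size e).
exists (Tuple sz); rewrite /= eqxx /=; apply: swaps_connect.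
exact: heap_eq_swaps.
Qed.
Local Notation is_std := (@is_std disp V adj).
Local Notation lexle := (@Defs.lexle disp V).

Lemma std_max w t : is_std w -> heap_eq w t -> lexle t w.
Proof.
move=> /forallP h e; have sz : size t == size w by rewrite (heap_eq_size e).
by have /implyP := h (Tuple sz); rewrite heap_eqbE; apply.
Qed.

(** Moving b in front of a forbidden factor gives a greater word for the same heap. Conversely,
    where w and an equivalent word first differ, the letter of the other word occurs later in w
    behind letters not linked to it, so it cannot be the greater one. *)
Lemma is_stdP w : reflect
  (forall p a u b s, w = p ++ a :: u ++ b :: s -> (a < b)%O -> ~~ free b (a :: u))
  (is_std w).
Proof.
apply: (iffP idP) => [h p a u b s ew ab|h].
  apply/negP => f.
  have e : heap_eq w (p ++ b :: (a :: u) ++ s) by rewrite ew -cat_cons; apply: heap_eq_move.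
  have := std_max h e; rewrite ew lexle_catl => /lexle_head.
  by rewrite leNgt ab.
apply/forallP => t; apply/implyP; rewrite heap_eqbE.
elim: w {t}(tval t) h => [|x w IH] [|y t] h e //; first by move/heap_eq_size: e.
case: (eqVneq x y) => [xy|ne].
  have e' : heap_eq w t by rewrite -(heap_eq_catl [:: x]); move: e; rewrite -xy.
  rewrite /= xy eqxx ltxx /= IH // => p a u b s ew.
  by apply: (h (x :: p) a u b s); rewrite ew.
have [u [s [ew f]]] := heap_eq_head e ne.
rewrite /=; case: (ltgtP y x) => //= [xy|eyx]; last by rewrite eyx eqxx in ne.
by have := h [::] x u y s; rewrite ew f => /(_ erefl xy).
Qed.

Lemma std_uniq w w' : is_std w -> is_std w' -> heap_eq w w' -> w = w'.
Proof.
move=> h h' e; apply: lexle_anti.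
by rewrite (std_max h) // (std_max h') // heap_eq_sym.
Qed.

Lemma std_factor p u s : is_std (p ++ u ++ s) -> is_std u.
Proof.
move/is_stdP => h; apply/is_stdP => p' a u' b s' eu ab.
by apply: (h (p ++ p') a u' b (s' ++ s)) => //; rewrite eu -!catA /= -catA.
Qed.

Lemma std_prefix u s : is_std (u ++ s) -> is_std u.
Proof. exact: (@std_factor [::]). Qed.

Lemma std_suffix p u : is_std (p ++ u) -> is_std u.
Proof. by rewrite -{1}(cats0 u); apply: std_factor. Qed.

Lemma std_exists w : exists h, is_std h && heap_eq w h.
Proof.
have lexmax (l : seq (seq V)) : l != [::] -> exists2 x, x \in l & all (lexle^~ x) l.
  elim: l => // x [|y l] IH _; first by exists x; rewrite ?mem_head //= lexle_refl.
  have [//|z zl h] := IH.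
  have [xz|zx] := orP (lexle_total x z).
    exists z; first by rewrite inE zl orbT.
    by apply/andP.
  exists x; first exact: mem_head.
  apply/andP; split=> //; apply: sub_all h => t tz; exact: lexle_trans zx.
have [|h] := lexmax [seq tval r | r <- enum [pred r : (size w).-tuple V | heap_eq w r]].
  suff : in_tuple w \in [pred r : (size w).-tuple V | heap_eq w r].
    by rewrite -mem_enum; case: (enum _).
  by rewrite inE /=.
case/mapP => r; rewrite mem_enum inE => e -> /allP hm; exists r.
rewrite e andbT; apply/forallP => r'; apply/implyP; rewrite heap_eqbE => e'.
have sz : size r' == size w by rewrite -(heap_eq_size e') size_tuple.
apply: (hm (Tuple sz)); apply/mapP; exists (Tuple sz) => //.
by rewrite mem_enum inE /=; apply: heap_eq_trans e'.
Qed.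

(* [acc] collects the letters of the pieces already known to lie above the bottom piece. *)
Fixpoint pyr_from (acc w : seq V) : bool :=
  if w is b :: w' then has (linked b) acc && pyr_from (b :: acc) w' else true.

Definition pyr w := if w is a :: s then pyr_from [:: a] s else false.

(** A letter enters [acc] exactly when its bit is set, so one pass from left to right replaces the
    transitive closure in [upmask]. *)
Fixpoint up_from (acc w : seq V) : bitseq :=
  if w is b :: w' then
    let m := has (linked b) acc in m :: up_from (if m then b :: acc else acc) w'
  else [::].

Lemma pyr_fromP acc w : reflect
  (forall u b s, w = u ++ b :: s -> has (linked b) (u ++ acc))
  (pyr_from acc w).
Proof.
elim: w acc => [|c w IH] acc /=; first by apply: ReflectT => -[].
apply: (iffP andP) => [[h /IH k] [|x u] b s /= [<- // ew]|h].
  by have := k _ _ _ ew; rewrite /= !has_cat /= orbCA.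
split; first exact: (h [::] c w).
apply/IH => u b s ew; have := h (c :: u) b s; rewrite ew => /(_ erefl).
by rewrite /= !has_cat /= orbCA.
Qed.

Lemma has_linked b u : has (linked b) u = ~~ free b u.
Proof. by rewrite /free all_predC negbK. Qed.

Lemma free_rcons b u a : free b (rcons u a) = free b (a :: u).
Proof. by rewrite /free all_rcons. Qed.

(** Levi's lemma for words. *)
Lemma cat_eq_cat (T : Type) (x y p q : seq T) : x ++ y = p ++ q ->
  (exists r, x = p ++ r /\ q = r ++ y) \/ (exists r, p = x ++ r /\ y = r ++ q).
Proof.
elim: x p => [|a x IH] [|b p] /=; [by right; exists [::]|by right; exists (b :: p)| |].
  by move=> <-; left; exists (a :: x).
by case=> -> /IH [[r [-> ->]]|[r [-> ->]]]; [left|right]; exists r.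
Qed.

(** A letter b > a linked to nothing before it would complete a forbidden factor starting at the
    leading a. *)
Lemma std_pyr a w : is_std (a :: w) -> all (fun c => (a <= c)%O) w -> pyr (a :: w).
Proof.
move=> /is_stdP h /allP am; apply/pyr_fromP => u b s ew.
rewrite cats1 has_linked free_rcons.
have : (a <= b)%O by apply: am; rewrite ew mem_cat mem_head orbT.
rewrite le_eqVlt => /orP[/eqP->|]; first by rewrite /free /= linked_refl.
by apply: (h [::] a u b s); rewrite ew.
Qed.

(** A forbidden factor across the seam would start at some c in v and end at some b > c in a :: w.
    As a is least, b is not the leading a; as a :: w is a pyramid, b is linked to a letter between
    the seam and itself, which lies inside the factor. *)
Lemma std_cat v a w : is_std v -> is_std (a :: w) -> all (fun c => (a <= c)%O) (v ++ w) ->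
  is_std (v ++ a :: w).
Proof.
move=> hx hy; rewrite all_cat => /andP[/allP ax aw].
have /pyr_fromP py := std_pyr hy aw.
apply/is_stdP => p c u b s e cb.
case: (cat_eq_cat e) => [[r [ex]]|[r [_ ey]]]; last by move/is_stdP: hy; apply; first exact: ey.
case: r ex => [|c' r] ex /=.
  by move=> ey; move/is_stdP: hy => /(_ [::] c u b s); apply.
case=> ec; rewrite -ec in ex * => {c' ec} /esym.
have cx : c \in v by rewrite ex mem_cat mem_head orbT.
have hd : b :: s = a :: w -> ~~ free b (c :: u).
  by case=> eb _; move: cb; rewrite eb ltNge ax.
case/cat_eq_cat => [[r' [er' eb]]|[r' [eu ey]]].
  case: r' er' eb => [_ /hd //|b' r' er' [eb _]].
  move/is_stdP: hx => /(_ p c u b r'); apply => //; by rewrite ex er' eb.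
case: r' eu ey => [_ /esym/hd //|a' r' eu [ea ew]].
have := py _ _ _ ew; rewrite cats1 has_rcons ea eu -has_linked /= has_cat /=.
by case/orP => ->; rewrite !orbT.
Qed.
End Heap.

(** * Pyramids *)

Section Pieces.
Variables (disp : Order.disp_t) (V : finOrderType disp) (adj : rel V).
Hypothesis adj_sym : symmetric adj.
Implicit Types (a b c x y : V) (p s t u v w acc : seq V).
Local Notation linked := (linked adj).
Local Notation pyr := (pyr adj).
Local Notation up_from := (up_from adj).
Local Notation prec := (@prec disp V adj).
Local Notation below := (@below disp V adj).
Local Notation pyramid := (@pyramid disp V adj).
Local Notation upmask := (@upmask disp V adj).

Lemma prec_nth x0 w i j : i < size w -> j < size w ->
  prec w i j = (i < j) && linked (nth x0 w i) (nth x0 w j).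
Proof. by move=> hi hj; rewrite /Defs.prec !onthE !(nth_map x0). Qed.

Lemma prec_lt w i j : prec w i j -> i < j. Proof. by case/andP. Qed.

Lemma below_last w (i j : 'I_(size w)) :
  below w i j = (i == j) || [exists l, below w i l && prec w l j].
Proof.
apply/idP/orP => [/connectP[q]|].
  case/lastP: q => [_ ->|q l]; first by left.
  rewrite rcons_path last_rcons => /andP[hq hl] ->; right.
  by apply/existsP; exists (last i q); apply/andP; split=> //; apply/connectP; exists q.
case=> [/eqP->|/existsP[l /andP[il lj]]]; first exact: connect0.
by apply: connect_trans il _; apply: connect1.
Qed.

Lemma pyramidE w : pyramid w = pyr w.
Proof.
rewrite /Defs.pyramid.
(* A piece is minimal for the transitive closure exactly when it has no direct predecessor. *)
have minE j : [forall i : 'I_(size w), (i != j) ==> ~~ below w i j]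
    = [forall i : 'I_(size w), ~~ prec w i j].
  apply/forallP/forallP => h i.
    have := h i; case: eqVneq => [-> _|_ /=].
      by apply/negP => /prec_lt; rewrite ltnn.
    apply: contra => pr; apply: connect1; exact: pr.
  apply/implyP => ne; rewrite below_last (negbTE ne) /=.
  by apply/existsPn => l; rewrite negb_and h orbT.
have -> : [set j : 'I_(size w) | [forall i : 'I_(size w), (i != j) ==> ~~ below w i j]]
    = [set j : 'I_(size w) | [forall i : 'I_(size w), ~~ prec w i j]].
  by apply/setP => j; rewrite !inE minE.
case: w {minE} => [|a w]; first by rewrite eq_card0 // => -[].
(* Position 0 is always minimal, so a pyramid is a word in which every later position has a direct
   predecessor. *)
have m0 : ord0 \in [set j : 'I_(size (a :: w)) | [forall i : 'I_(size (a :: w)), ~~ prec (a :: w) i j]].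
  by rewrite inE; apply/forallP => i; apply/negP => /prec_lt.
apply/idP/idP => [/cards1P[j0 e]|/pyr_fromP h].
  have {e} e : [set j : 'I_(size (a :: w)) | [forall i : 'I_(size (a :: w)), ~~ prec (a :: w) i j]] = [set ord0].
    by move: m0; rewrite e inE => /eqP->.
  apply/pyr_fromP => u b s ew.
  have ltj : (size u).+1 < size (a :: w) by rewrite ew /= size_cat /= addnS !ltnS leq_addr.
  have : Ordinal ltj \notin [set ord0] by rewrite inE.
  rewrite -e inE => /forallPn[i]; rewrite negbK (prec_nth a) //= => /andP[].
move: (nat_of_ord i) => {i} i lti; rewrite ew nth_cat ltnn subnn linked_sym // => l.
apply/hasP; exists (nth a (a :: u ++ b :: s) i) => //.
case: i lti {l} => [|k]; first by rewrite /= mem_cat mem_head orbT.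
by rewrite /= !ltnS => lk; rewrite nth_cat lk mem_cat mem_nth.
apply/cards1P; exists ord0; apply/setP => j; rewrite in_set1.
apply/idP/eqP => [|-> //]; rewrite inE => /forallP hj; apply: val_inj => /=.
case E: (val j) => [//|k]; have lk : k < size w by have := ltn_ord j; rewrite E.
have := h (take k w) (nth a w k) (drop k.+1 w).
rewrite -drop_nth // cat_take_drop => /(_ erefl) /hasP[c]; rewrite mem_cat inE => hc l.
have [i [lik ei]] : exists i, i <= k /\ nth a (a :: w) i = c.
  case/orP: hc => [ct|/eqP->]; last by exists 0.
  have := ct; rewrite -index_mem size_take lk => lt.
  by exists (index c (take k w)).+1; rewrite /= -(nth_take a lt) nth_index.
have lti : i < size (a :: w) by rewrite ltnS (leq_trans lik) // ltnW.
have := hj (Ordinal lti); rewrite (prec_nth a) //= E ltnS lik /= ei.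
by rewrite linked_sym // l.
Qed.

Lemma size_up_from acc w : size (up_from acc w) = size w.
Proof. by elim: w acc => //= b w IH acc; rewrite IH. Qed.

Lemma size_upmask w i : size (upmask w i) = size w.
Proof. by rewrite size_map size_enum_ord. Qed.

Lemma has_mask x0 (f : pred V) (m : bitseq) w :
  has f (mask m w) = has (fun l => nth false m l && f (nth x0 w l)) (iota 0 (size w)).
Proof.
elim: w m => [|x w IH] [|b m] //.
  by symmetry; apply/hasPn => l _; rewrite nth_nil.
rewrite [LHS]/= [RHS]/= (iotaDl 1 0) has_map.
by case: b => /=; rewrite IH.
Qed.

Lemma nth_up_from x0 acc w k : k < size w -> nth false (up_from acc w) k =
  has (linked (nth x0 w k)) (acc ++ mask (take k (up_from acc w)) (take k w)).
Proof.
elim: w acc k => // b w IH acc [_|k] /=; first by rewrite ?take0 cats0.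
rewrite ltnS => /IH -> /=; case: ifP => //= _.
by rewrite !has_cat /= orbCA.
Qed.

Lemma nth_upmask w i k : i < size w -> k < size w ->
  nth false (upmask w i) k = (k == i) ||
  has (fun l => nth false (upmask w i) l && prec w l k) (iota 0 (size w)).
Proof.
move=> hi hk.
have E l (hl : l < size w) : nth false (upmask w i) l = below w (Ordinal hi) (Ordinal hl).
  rewrite (nth_map (Ordinal hi)) ?size_enum_ord //.
  have -> : nth (Ordinal hi) (enum 'I_(size w)) l = Ordinal hl.
    by apply: val_inj; rewrite /= nth_enum_ord.
  apply/existsP/idP => [[x /andP[/eqP xi]]|b]; last by exists (Ordinal hi); rewrite /= eqxx b.
  by rewrite (_ : x = Ordinal hi) //; apply: val_inj; rewrite /= -xi.
rewrite E below_last -val_eqE /= eq_sym; congr (_ || _).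
apply/existsP/hasP => [[l h]|[l]].
  exists (val l); first by rewrite mem_iota /= add0n ltn_ord.
  by rewrite (E _ (ltn_ord l)) (_ : Ordinal (ltn_ord l) = l) //; apply: val_inj.
rewrite mem_iota /= add0n => hl h; exists (Ordinal hl).
by rewrite -E.
Qed.

(** Both masks solve the same recursion: a position is marked if it is the base or has a marked
    direct predecessor. Predecessors come strictly earlier, so strong induction identifies the
    two. *)
Lemma upmaskE p c s : upmask (p ++ c :: s) (size p) =
  nseq (size p) false ++ true :: up_from [:: c] s.
Proof.
set w := p ++ c :: s; set m := nseq _ _ ++ _.
have szm : size m = size w by rewrite /m /w !size_cat size_nseq /= size_up_from.
have hi : size p < size w by rewrite size_cat /= -addSnnS leq_addr.
have mE k : k < size w -> nth false m k = (k == size p) ||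
    has (linked (nth c w k)) (mask (take k m) (take k w)).
  move=> hk; rewrite /m nth_cat size_nseq; case: ltngtP => hkp /=.
  - rewrite nth_nseq hkp take_cat size_nseq hkp take_nseq 1?ltnW //.
    by rewrite (_ : mask _ _ = [::]) // mask_false.
  - have [j ej] : exists j, k = size p + j.+1.
      by exists (k - (size p).+1); rewrite -addSnnS subnKC.
    rewrite ej addKn /w nth_cat ltnNge leq_addr /= addKn /=.
    rewrite !take_cat size_nseq ltnNge leq_addr /= !addKn /=.
    rewrite mask_cat ?size_nseq // mask_false /=.
    move: hk; rewrite ej /w size_cat ltn_add2l /= ltnS => hj.
    by rewrite (nth_up_from c).
  - by rewrite hkp subnn.
apply: (@eq_from_nth _ false) => [|k]; rewrite size_upmask ?szm //.
elim/ltn_ind: k => k IH hk; rewrite nth_upmask // mE //; congr (_ || _).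
rewrite (has_mask c) size_take hk.
apply/hasP/hasP => -[l]; rewrite !mem_iota /= add0n => hl /andP[hm hp]; exists l.
- by rewrite mem_iota (prec_lt hp).
- have lk := prec_lt hp; move: hp; rewrite (prec_nth c) // lk /= !nth_take //.
  by rewrite -IH // hm linked_sym.
- by rewrite mem_iota /= add0n (ltn_trans hl hk).
- have hlw := ltn_trans hl hk; rewrite IH // (prec_nth c) // hl.
  by rewrite !nth_take // in hm hp *; rewrite hm linked_sym.
Qed.
End Pieces.

(** * Lyndon heaps are standard Lyndon words *)

(** The Euclidean algorithm on lengths: the shorter word is a prefix of the longer one, and the
    remainder still commutes with it. *)
Lemma cat_commute_power (T : eqType) (p s : seq T) : p ++ s = s ++ p ->
  p != [::] -> s != [::] ->
  exists v j k, [/\ v != [::], p = flatten (nseq j.+1 v) & s = flatten (nseq k.+1 v)].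
Proof.
have cat_pow (v : seq T) i j : flatten (nseq i v) ++ flatten (nseq j v) = flatten (nseq (i + j) v).
  by rewrite nseqD flatten_cat.
have [n] := ubnP (size p + size s); elim: n p s => // n IH.
suff core (p s : seq T) : size p + size s < n.+1 -> size s < size p -> p ++ s = s ++ p -> p != [::] -> s != [::] ->
    exists v j k, [/\ v != [::], p = flatten (nseq j.+1 v) & s = flatten (nseq k.+1 v)].
  move=> p s lt e p0 s0; case: (ltngtP (size s) (size p)) => h; first exact: core.
    have [|v [j [k [? ? ?]]]] := core s p _ h (esym e) s0 p0; first by rewrite addnC.
    by exists v, k, j.
  exists s, 0, 0; rewrite /= cats0; split=> //.
  by have := congr1 (take (size s)) e; rewrite take_size_cat // [in RHS]take_size_cat.
move=> lt h e p0 s0.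
have [[r [ep er]]|[r [es _]]] := cat_eq_cat e; last first.
  by move: h; rewrite es size_cat ltnNge leq_addr.
have r0 : r != [::] by apply: contraTneq h => r0; rewrite ep r0 cats0 ltnn.
have [||v [j [k [v0 ej ek]]]] := IH r s _ _ r0 s0.
- rewrite -ltnS; apply: leq_trans lt; rewrite ltnS ltn_add2r ep size_cat.
  by rewrite -[X in X < _]add0n ltn_add2r lt0n size_eq0.
- by rewrite -er ep.
exists v, (k + j.+1), k; split=> //.
by rewrite ep ek ej cat_pow addSn.
Qed.

Section Lyndon.
Variables (disp : Order.disp_t) (V : finOrderType disp) (adj : rel V).
Hypothesis adj_sym : symmetric adj.
Implicit Types (a b c x y : V) (p s t u v w acc : seq V).
Local Notation linked := (linked adj).
Local Notation heap_eq := (heap_eq adj).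
Local Notation pyr_from := (pyr_from adj).
Local Notation pyr := (pyr adj).
Local Notation up_from := (up_from adj).
Local Notation is_std := (@is_std disp V adj).
Local Notation lexle := (@Defs.lexle disp V).
Local Notation rot := (@Defs.rot disp V adj).
Local Notation Ainf := (@Defs.Ainf disp V adj).

Lemma rotE p c s : rot (p ++ c :: s) (size p) =
  (c :: mask (up_from [:: c] s) s) ++ p ++ mask (map negb (up_from [:: c] s)) s.
Proof.
rewrite /Defs.rot upmaskE // map_cat map_nseq /= !mask_cat ?size_nseq //.
by rewrite mask_false mask_true.
Qed.

Lemma pyr_from_mask acc w : pyr_from acc (mask (up_from acc w) w).
Proof. by elim: w acc => //= b w IH acc; case: ifP => h; rewrite /= ?h IH. Qed.

Lemma up_from_pyr acc w : pyr_from acc w -> up_from acc w = nseq (size w) true.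
Proof. by elim: w acc => //= b w IH acc /andP[-> /IH ->]. Qed.

Lemma up_from_cat acc v w : pyr_from acc v ->
  up_from acc (v ++ w) = nseq (size v) true ++ up_from (catrev v acc) w.
Proof. by elim: v acc => //= b v IH acc /andP[-> /IH ->]. Qed.

Lemma count_up_from_gt0 acc w :
  has (fun b => has (linked b) acc) w -> 0 < count id (up_from acc w).
Proof. by elim: w acc => //= b w IH acc; case: (has (linked b) acc) => //= /IH. Qed.

Lemma pyr_from_connected (A : pred V) acc w d : pyr_from acc w -> all (fun x => A x == d) acc ->
  all (fun x => A x == d) w \/
  exists x y, [/\ x \in acc ++ w, y \in acc ++ w, linked x y & A x != A y].
Proof.
elim: w acc => [|b w IH] acc /=; first by left.
case/andP => /hasP[c ca l] hw hA; have Ac := allP hA c ca.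
case: (eqVneq (A b) d) => [Ab|nAb].
  have [|h|[x [y [hx hy lxy ne]]]] := IH (b :: acc) hw; first by rewrite /= Ab eqxx.
    by left.
  right; exists x, y; split=> //.
    by move: hx; rewrite !mem_cat !inE orbCA orbA.
  by move: hy; rewrite !mem_cat !inE orbCA orbA.
right; exists b, c; split=> //; rewrite ?mem_cat ?ca ?inE ?eqxx ?orbT //.
by rewrite (eqP Ac).
Qed.

(** Connectedness of the linkage graph on the letters of w, through predicates constant along links.
    It depends on the set of letters only and therefore survives rotations. *)
Definition connected w := forall A : pred V,
  (forall x y, x \in w -> y \in w -> linked x y -> A x = A y) ->
  forall x y, x \in w -> y \in w -> A x = A y.

Lemma pyr_connected w : pyr w -> connected w.
Proof.
case: w => // a w hp A hA.
have [|h|[x [y [hx hy l]]]] := @pyr_from_connected A [:: a] w (A a) hp; first by rewrite /= eqxx.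
  have {}h x : x \in a :: w -> A x = A a by rewrite inE => /orP[/eqP->//|/(allP h)/eqP].
  by move=> x y /h -> /h ->.
by rewrite (hA x y) // eqxx.
Qed.

Lemma perm_mask_negb (m : bitseq) w : size m = size w ->
  perm_eq (mask m w ++ mask (map negb m) w) w.
Proof.
elim: w m => [|x w IH] [|b m] //= [/IH h]; case: b => /=; first by rewrite perm_cons.
by rewrite -cat_rcons -cats1 -catA perm_catCA /= perm_cons.
Qed.

Lemma perm_connected w w' : perm_eq w w' -> connected w -> connected w'.
Proof.
move=> /perm_mem e h A hA x y; rewrite -!e; apply: h => {}x {}y; rewrite !e; exact: hA.
Qed.

(** The pieces above c move to the front and stay above c. If no piece were gained, no letter of the
    remainder would be linked to a letter of the upper part; connectedness then makes the remainder
    empty, against the second hypothesis. *)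
Lemma rot0_grows c s : connected (c :: s) -> ~~ pyr_from [:: c] s ->
  count id (up_from [:: c] s) < count id (up_from [:: c] (mask (up_from [:: c] s) s ++ mask (map negb (up_from [:: c] s)) s)).
Proof.
move=> hc; set m := up_from [:: c] s => np; have szm : size m = size s by apply: size_up_from.
rewrite up_from_cat ?pyr_from_mask // count_cat count_nseq mul1n size_mask //.
rewrite -[X in X < _]addn0 ltn_add2l; apply: count_up_from_gt0.
apply: contraNT np => /hasPn no.
have mU x : x \in c :: s -> x \notin c :: mask m s -> x \in mask (map negb m) s.
  by rewrite !inE negb_or -(perm_mem (perm_mask_negb szm)) mem_cat => hx /andP[/negPf n1 /negPf n2]; rewrite n1 n2 in hx.
have inacc x : (x \in catrev (mask m s) [:: c]) = (x \in c :: mask m s).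
  by rewrite catrevE mem_cat mem_rev inE orbC inE.
have U0 x : x \in mask (map negb m) s -> False.
  move=> xU; have xc : x \in c :: s.
    by rewrite inE -(perm_mem (perm_mask_negb szm)) mem_cat xU !orbT.
  have nx z : z \in mask (map negb m) s -> z \notin c :: mask m s.
    by move=> /no; apply: contra; rewrite -inacc => h; apply/hasP; exists z; rewrite ?linked_refl.
  suff e : (x \in c :: mask m s) = (c \in c :: mask m s).
    by have := nx _ xU; rewrite e mem_head.
  apply: (hc (mem (c :: mask m s))) => //; last exact: mem_head.
  move=> y z hy hz l.
  apply/idP/idP => h; apply: contraTT l => hn.
    have /hasPn := no _ (mU _ hz hn); rewrite linked_sym //; apply; by rewrite inacc.
  by have /hasPn := no _ (mU _ hy hn); apply; rewrite inacc.
have -> : s = mask m s; last exact: pyr_from_mask.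
apply/esym/eqP; rewrite -(size_subseq_leqif (mask_subseq m s)).
rewrite -(perm_size (perm_mask_negb szm)) size_cat.
by case: (mask (map negb m) s) U0 => [|x r] => [_|/(_ x (mem_head _ _))//]; rewrite addn0.
Qed.

Lemma perm_rot p c s : perm_eq (rot (p ++ c :: s) (size p)) (p ++ c :: s).
Proof.
have h := perm_mask_negb (size_up_from adj [:: c] s).
by rewrite rotE /= perm_sym perm_catC /= perm_cons perm_catC perm_sym perm_catCA perm_cat2l.
Qed.

(* Each rotation that does not yet give a pyramid strictly enlarges the set of pieces above p. *)
Lemma Ainf_pyr p c s : pyr (p ++ c :: s) ->
  exists s', [/\ Ainf (p ++ c :: s) (size p) = c :: s', pyr (c :: s') &
    perm_eq (c :: s') (p ++ c :: s)].
Proof.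
move=> hp; set w := p ++ c :: s; rewrite /Defs.Ainf.
have step j : exists s', [/\ iter j (fun u => rot u 0) (rot w (size p)) = c :: s',
    perm_eq (c :: s') w & pyr_from [:: c] s' || (j <= count id (up_from [:: c] s'))].
  elim: j => [|j [s' [e pm h]]].
    exists (mask (up_from [:: c] s) s ++ p ++ mask (map negb (up_from [:: c] s)) s).
    by rewrite orbT /= -cat_cons -rotE; split=> //; apply: perm_rot.
  exists (mask (up_from [:: c] s') s' ++ mask (map negb (up_from [:: c] s')) s').
  rewrite iterS e (rotE [::]); split=> //.
    by apply: perm_trans pm; have := perm_rot [::] c s'; rewrite (rotE [::]).
  case: (boolP (pyr_from [:: c] s')) h => [hs _|np /= h].
    by rewrite (up_from_pyr hs) map_nseq mask_true // mask_false cats0 hs.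
  apply/orP; right; apply: leq_ltn_trans h (rot0_grows _ np).
  by apply: perm_connected (pyr_connected hp); rewrite perm_sym.
have [s' [e pm /orP[h|h]]] := step (size w); first by exists s'; split.
(* At most [size s'] pieces can be counted, one fewer than the [size w] iterations in [Ainf]. *)
have := leq_trans h (count_size _ _).
by rewrite size_up_from -(perm_size pm) ltnn.
Qed.

Lemma pyr_head a w b t : pyr (a :: w) -> heap_eq (a :: w) (b :: t) -> a = b.
Proof.
move=> /pyr_fromP h e; case: (eqVneq a b) => // ne.
have [u [s [ew f]]] := heap_eq_head e ne.
by have := h _ _ _ ew; rewrite cats1 has_linked free_rcons f.
Qed.

Lemma pyr_heap_eq_cons a w t : pyr (a :: w) -> heap_eq (a :: w) t -> exists t', t = a :: t'.
Proof.
case: t => [|b t] hp e; first by have := heap_eq_size e.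
by rewrite (pyr_head hp e); exists t.
Qed.

(** Lyndon words in the classical sense: since proper suffixes differ from w in length, the weak
    comparison with them is a strict one. *)
Definition lyndon_word w :=
  (w != [::]) && all (fun i => lexle w (drop i w)) (iota 0 (size w)).

Lemma lyndon_wordP w : reflect
  (w != [::] /\ forall p s, w = p ++ s -> s != [::] -> lexle w s)
  (lyndon_word w).
Proof.
apply: (iffP andP) => -[w0 h]; split=> //.
  move=> p s ew s0; have : size p \in iota 0 (size w).
    by rewrite mem_iota ew size_cat -[X in X < _]addn0 ltn_add2l lt0n size_eq0.
  by move/(allP h); rewrite {2}ew drop_size_cat.
apply/allP => i; rewrite mem_iota add0n /= => hi; apply: (h (take i w)).
  by rewrite cat_take_drop.
by rewrite -size_eq0 size_drop subn_eq0 -ltnNge.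
Qed.

Lemma lyndon_word_min a w : lyndon_word (a :: w) -> all (fun c => (a <= c)%O) w.
Proof.
case/lyndon_wordP => _ h; apply/allP => c /mem_first_split [u [s [ew _]]].
by apply: lexle_head (h (a :: u) (c :: s) _ _) => //; rewrite ew.
Qed.

Lemma std_pow a w m : is_std (a :: w) -> all (fun c => (a <= c)%O) w ->
  is_std (flatten (nseq m.+1 (a :: w))).
Proof.
move=> hs am; elim: m => [|m IH]; first by rewrite /= cats0.
apply: (@std_cat _ _ adj adj_sym (a :: w) a (w ++ flatten (nseq m (a :: w)))) => //.
have {}am x : x \in a :: w -> (a <= x)%O by rewrite inE => /orP[/eqP->|/(allP am)].
apply/allP => x; rewrite !mem_cat => /orP[/am//|/orP[xw|/flattenP[v]]].
  by apply: am; rewrite inE xw orbT.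
by rewrite mem_nseq => /andP[_ /eqP->] /am.
Qed.

(** The suffix c :: s is a pyramid by [std_pyr], so nothing of it is left behind and one [rot] is
    cyclic rotation; the result is again a pyramid, hence fixed by further rotations. *)
Lemma std_rotation p c s : is_std (p ++ c :: s) -> all (fun x => (c <= x)%O) (p ++ c :: s) ->
  ohead p = Some c \/ p = [::] -> 
  Ainf (p ++ c :: s) (size p) = (c :: s) ++ p /\ is_std ((c :: s) ++ p).
Proof.
move=> hs hall hp.
have hm x : x \in p ++ c :: s -> (c <= x)%O by move/(allP hall).
have hsuf := std_suffix adj_sym hs.
have spyr : pyr_from [:: c] s.
  by apply: (@std_pyr _ _ adj adj_sym c s hsuf); apply/allP => x xs; apply: hm; rewrite mem_cat inE xs !orbT.
have hcat : is_std ((c :: s) ++ p).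
  case: hp hs hm {hall} => [|-> _]; last by rewrite cats0.
  case: p => // c' p [->] hs hm; apply: std_cat => //.
    exact: (std_prefix adj_sym hs).
  apply/allP => x xx; apply: hm; move: xx; rewrite !(mem_cat, inE).
  by case/orP=> [/orP[->|->]|->]; rewrite ?orbT.
split=> //; have cpyr : pyr_from [:: c] (s ++ p).
  apply: (@std_pyr _ _ adj adj_sym c (s ++ p) hcat); apply/allP => x xx; apply: hm.
  by move: xx; rewrite !mem_cat inE; case/orP => ->; rewrite ?orbT.
rewrite /Defs.Ainf rotE (up_from_pyr spyr) map_nseq mask_true // mask_false cats0.
elim: (size _) => // n IH; rewrite iterS IH /= (rotE [::]) (up_from_pyr cpyr).
by rewrite map_nseq mask_true // mask_false !cats0.
Qed.

(** Bottom letters of the rotated pyramids show that w starts with its least letter, so w is minimal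
    among its cyclic rotations. Aperiodicity forbids commuting factors p, s of w, and the two facts
    together exclude a suffix below w. *)
Lemma lyndon_normal_word w : lyndon adj w -> is_std w && lyndon_word w.
Proof.
case/and4P => hs; rewrite pyramidE // => hp hper /forallP hmin; rewrite hs /=.
have minA p c s t : w = p ++ c :: s -> is_std t ->
    heap_eq t (Ainf w (size p)) -> lexle w t.
  move=> ew ht e.
  have lti : size p < size w by rewrite ew size_cat /= -addSnnS leq_addr.
  have sz : size t == size w.
    rewrite (heap_eq_size e); move: hp; rewrite ew => /Ainf_pyr[s' [-> _ pm]].
    by rewrite (perm_size pm).
  have /forallP/(_ (Tuple sz))/implyP := hmin (Ordinal lti).
  by apply; rewrite /= ht heap_eqbE.
have [a [w' ew]] : exists a w', w = a :: w' by case: w hp {hs hper hmin minA} => // a w' _; exists a, w'.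
have amin x : x \in w -> (a <= x)%O.
  case/mem_first_split => p [s [es _]].
  have [s' [eA py pm]] : exists s', [/\ Ainf w (size p) = x :: s', pyr (x :: s') & perm_eq (x :: s') w].
    by rewrite es; apply: Ainf_pyr; rewrite -es.
  have [h /andP[hh e]] := std_exists adj_sym (x :: s').
  have [h' eh] := pyr_heap_eq_cons py e.
  have := minA _ _ _ h es hh; rewrite eA heap_eq_sym => /(_ e).
  by rewrite eh ew => /lexle_head.
have rotmin p s : w = p ++ s -> lexle w (s ++ p).
  case: s => [|c s] es; first by rewrite es cats0 lexle_refl.
  have hall : all (fun x => (a <= x)%O) w by apply/allP.
  case: (eqVneq c a) => [ca|ne]; last first.
    rewrite ew /= lt_neqAle eq_sym ne amin // es mem_cat mem_head orbT //.
  rewrite {}ca in es *; have [|||eA hr] := @std_rotation p a s; rewrite -?es //.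
    by case: p es => [|c' p]; [right|rewrite ew => -[<-]; left].
  by apply: (minA p a s) => //; rewrite es eA heap_eq_refl.
have commute p s : w = p ++ s -> p != [::] -> s != [::] -> p ++ s <> s ++ p.
  move=> es p0 s0 /cat_commute_power /(_ p0 s0) [v [j [k [v0 ep ek]]]].
  have [n n1 ewv] : exists2 n, 1 < n & w = flatten (nseq n v).
    exists (j.+1 + k.+1); first by rewrite addnS.
    by rewrite es ep ek nseqD flatten_cat.
  have vgt : 0 < size v by rewrite lt0n size_eq0.
  have szw : size w = n * size v.
    by rewrite ewv size_flatten /shape map_nseq sumn_nseq mulnC.
  have ltm : n < (size w).+1 by rewrite ltnS szw leq_pmulr.
  case/negP: hper; apply/existsP; exists (Ordinal ltm); rewrite /= n1.
  have szv : size v == size w %/ n by rewrite szw mulKn // ltnW.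
  by apply/existsP; exists (Tuple szv); rewrite heap_eqbE //= -ewv heap_eq_refl.
apply/lyndon_wordP; split=> [|p s es s0]; first by rewrite ew.
case: (eqVneq p [::]) => [p0|p0]; first by rewrite es p0 lexle_refl.
(* If s is also a prefix, w = s u, then comparing w with its rotations u s and s p forces u = p, and
   p commutes with s. Otherwise s p is at most w, so it equals w, with the same contradiction. *)
case/orP: (lexle_total w s) => // /lexle_prefix_or [[u eu]|h].
  have szu : size u = size p by apply/eqP; rewrite -(eqn_add2l (size s)) -size_cat -eu es size_cat addnC.
  have := rotmin _ _ eu; rewrite {1}es => /(lexle_eqsize_catr (esym szu)) pu.
  have := rotmin _ _ es; rewrite {1}eu lexle_catl => up.
  case: (commute p s es p0 s0); rewrite -es eu; congr (_ ++ _).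
  by apply: lexle_anti; rewrite up pu.
case: (commute p s es p0 s0); rewrite -es; apply: lexle_anti.
by rewrite rotmin //= -[X in lexle _ X]cats0 h.
Qed.

Lemma lyndonP w : reflect (is_std w /\ lyndon_word w) (lyndon adj w).
Proof.
apply: (iffP idP) => [/lyndon_normal_word/andP//|[hs hl]].
have [a [w' ew]] : exists a w', w = a :: w'.
  by case/lyndon_wordP: hl; case: w {hs} => // a w' _ _; exists a, w'.
have amin : all (fun c => (a <= c)%O) w' by apply: lyndon_word_min; rewrite -ew.
have hp : pyr w by rewrite ew; apply: (std_pyr adj_sym) => //; rewrite -ew.
have [_ hmin] := lyndon_wordP _ hl.
apply/and4P; split=> //; first by rewrite pyramidE.
  apply/negP => /existsP[m /andP[m1 /existsP[u]]]; rewrite heap_eqbE // => e.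
  (* The root u need not be standard. Its standard word k starts with the least letter a, so the
     power of k is standard and equals w as a word; then k is both a prefix and a proper suffix of
     w. *)
  have [k /andP[hk ek]] := std_exists adj_sym u.
  have {e ek} e : heap_eq w (flatten (nseq m k)).
    apply: heap_eq_trans e _; move: (tval u) ek => v ek.
    elim: (nat_of_ord m) => [|n IH] /=; first exact: heap_eq_refl.
    exact: heap_eq_cat.
  case: (nat_of_ord m) m1 e => [|[|n]] // _ e.
  case: k hk e => [|c k] hk e.
    have : size w = 0 by rewrite (heap_eq_size e) size_flatten /shape map_nseq sumn_nseq.
    by rewrite ew.
  have ac : a = c by move: e hp; rewrite ew => e' hp'; apply: pyr_head hp' e'.
  rewrite -{c}ac in hk e.
  have kmin : all (fun c => (a <= c)%O) k.
    apply/allP => x xk; have : x \in w.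
      by rewrite (perm_mem (heap_eq_perm e)); apply/flattenP; exists (a :: k); rewrite ?mem_nseq ?eqxx // inE xk orbT.
    by rewrite ew inE => /orP[/eqP->|/(allP amin)].
  have {}e : w = flatten (nseq n.+2 (a :: k)) by apply: std_uniq e => //; apply: std_pow.
  have e2 : w = flatten (nseq n.+1 (a :: k)) ++ (a :: k).
    by rewrite e -addn1 nseqD flatten_cat /= cats0.
  have h1 := hmin _ _ e2 isT; have h2 : lexle (a :: k) w by rewrite e; apply: lexle_prefix.
  have wk : w = a :: k by apply: lexle_anti; rewrite h1 h2.
  move/(congr1 size)/eqP: e; rewrite size_flatten /shape map_nseq sumn_nseq wk.
  by rewrite -[X in X == _]muln1 eqn_pmul2l.
apply/forallP => i; apply/forallP => t; apply/implyP => /andP[ht]; rewrite heap_eqbE // => e.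
have [p [c [s [es ei]]]] : exists p c s, w = p ++ c :: s /\ size p = i.
  exists (take i w), (nth a w i), (drop i.+1 w).
  by rewrite -drop_nth // cat_take_drop size_takel // ltnW.
(* At a letter other than a, comparing first letters suffices. At an a, the rotation is cyclic and
   starts with the suffix c :: s, which is at least w. *)
have [ca|ne] := eqVneq c a; last first.
  have := @Ainf_pyr p c s; rewrite -es ei => /(_ hp)[s' [eA hA pm]].
  have := std_max adj_sym ht e; rewrite eA.
  case: (tval t) => [//|y t'].
  move=> /lexle_head cy; rewrite ew /=.
  have ca : (a <= c)%O.
    have : c \in w by rewrite es mem_cat mem_head orbT.
    by rewrite ew inE (negbTE ne) => /(allP amin).
  by rewrite (lt_le_trans _ cy) // lt_neqAle eq_sym ne.
have [|||eA hr] := @std_rotation p c s; rewrite -?es //.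
- by rewrite ew ca /= lexx.
- by move: ew; rewrite es; case: (p) => [|c' p']; [right|case=> -> _; left; rewrite ca].
have -> : tval t = (c :: s) ++ p.
  by apply: (std_uniq adj_sym) => //; rewrite -eA -es ei.
by apply: lexle_trans (lexle_prefix _ _); apply: hmin es _.
Qed.
End Lyndon.

(** * Lyndon factorization *)

(* Coefficient of t^n in the product of the series 1 / (1 - t^k), k in sigma. *)
Fixpoint hcount (sigma : seq nat) (n : nat) : nat :=
  if sigma is k :: sigma' then
    \sum_(b <- iota 0 n.+1 | k %| b) hcount sigma' (n - b)
  else (n == 0).

Section Factorization.
Variables (disp : Order.disp_t) (V : finOrderType disp).
Implicit Types (a : V) (p q u v w l x : seq V) (s : seq (seq V)).
Local Notation lexle := (@Defs.lexle disp V).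
Local Notation lyndon_word := (@lyndon_word disp V).

(* A factorization is stored as a lexicographically nondecreasing list, last factor first. *)
Lemma flatten_rev_cons l s : flatten (rev (l :: s)) = flatten (rev s) ++ l.
Proof. by rewrite rev_cons flatten_rcons. Qed.

(** The last factor is thus recovered from the product as its least nonempty suffix, which yields
    uniqueness. A suffix longer than l starts with a nonempty suffix of the earlier factors, which
    is at least their own last factor l' by induction. *)
Lemma lyndon_min_suffix l s p x : sorted lexle (l :: s) -> all lyndon_word (l :: s) ->
  flatten (rev (l :: s)) = p ++ x -> x != [::] -> lexle l x.
Proof.
elim: s l p x => [|l' s IH] l p x; rewrite flatten_rev_cons => hs /andP[/lyndon_wordP[_ hl] ha] e x0.
  exact: (hl p).
case: (cat_eq_cat e) => [[r [er ->]]|[r [ep el]]]; last exact: (hl r).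
have /andP[ll' hs'] := hs.
case: (eqVneq r [::]) => [->|r0]; first exact: lexle_refl.
apply: lexle_trans ll' _; apply: lexle_trans (lexle_prefix _ _).
exact: IH er r0.
Qed.

Lemma lyndon_factorization_uniq s s' : sorted lexle s -> sorted lexle s' ->
  all lyndon_word s -> all lyndon_word s' ->
  flatten (rev s) = flatten (rev s') -> s = s'.
Proof.
have ne l : lyndon_word l -> l != [::] by case/andP.
elim: s s' => [|l s IH] [|l' s'] // hs hs' hl hl'.
- have /ne l'0 := allP hl' _ (mem_head _ _).
  rewrite flatten_rev_cons => /(congr1 size)/eqP; rewrite size_cat /= eq_sym addn_eq0.
  by rewrite (size_eq0 l') (negbTE l'0) andbF.
- have /ne l0 := allP hl _ (mem_head _ _).
  rewrite flatten_rev_cons => /(congr1 size)/eqP; rewrite size_cat /= addn_eq0.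
  by rewrite (size_eq0 l) (negbTE l0) andbF.
move=> e; have l0 := ne _ (allP hl _ (mem_head _ _)); have l'0 := ne _ (allP hl' _ (mem_head _ _)).
have ell : l = l'.
  apply: lexle_anti; rewrite (@lyndon_min_suffix l s (flatten (rev s')) l') //=.
    by rewrite (@lyndon_min_suffix l' s' (flatten (rev s)) l) // -e flatten_rev_cons.
  by rewrite e flatten_rev_cons.
rewrite -{l' l'0}ell in hs' hl' e *; congr (_ :: _); apply: IH.
- exact: path_sorted hs.
- exact: path_sorted hs'.
- by case/andP: hl.
- by case/andP: hl'.
move: e; rewrite !flatten_rev_cons => e.
have sz : size (flatten (rev s)) = size (flatten (rev s')).
  by move/(congr1 size)/eqP: e; rewrite !size_cat eqn_add2r => /eqP.
by move/eqP: e; rewrite eqseq_cat // => /andP[/eqP].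
Qed.

Lemma min_suffix_exists w : w != [::] -> exists p v, [/\ w = p ++ v, v != [::] &
  forall q x, w = q ++ x -> x != [::] -> lexle v x].
Proof.
elim: w => // a w IH _; case: (eqVneq w [::]) => [->|w0].
  exists [::], [:: a]; split=> // -[|b q] x; first by move=> /= <- _; rewrite eqxx orbT.
  by case=> _; case: q x => [|? ?] [].
have [p [v [ew v0 h]]] := IH w0; case/orP: (lexle_total v (a :: w)) => le.
  exists (a :: p), v; split=> //; first by rewrite ew.
  by move=> [|b q] x; [by move=> /= <-|case=> _ e x0; apply: h e x0].
exists [::], (a :: w); split=> // -[|b q] x; first by rewrite cat0s => <- _; apply: lexle_refl.
case=> _ e x0.
exact: lexle_trans le (h q x e x0).
Qed.

(** The least nonempty suffix v is split off; it is Lyndon since its suffixes are suffixes of w. The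
    preceding factor l is at least v because l v is a suffix too: from l <= v one gets v = l v, or v
    = l u with either u empty or u = v. *)
Lemma lyndon_factorization w : exists s, [/\ sorted lexle s, all lyndon_word s & flatten (rev s) = w].
Proof.
have [n] := ubnP (size w); elim: n w => // n IH w hn.
case: (eqVneq w [::]) => [->|w0]; first by exists [::].
have [p [v [ew v0 h]]] := min_suffix_exists w0.
have [|s [hs hl es]] := IH p.
  rewrite -ltnS; apply: leq_trans hn; rewrite ltnS ew size_cat -[X in X < _]addn0 ltn_add2l.
  by rewrite lt0n size_eq0.
have lv : lyndon_word v.
  by apply/lyndon_wordP; split=> // q x ev; apply: (h (p ++ q)); rewrite ew ev catA.
exists (v :: s); split; last by rewrite flatten_rev_cons es ew.
  case: s hs hl es => //= l s -> /andP[/lyndon_wordP[l0 ll] _]; rewrite flatten_rev_cons => es.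
  rewrite andbT; case/orP: (lexle_total v l) => // lv'.
  have vlv : lexle v (l ++ v) by apply: (h (flatten (rev s))); rewrite ?ew -?es ?catA //; case: (l) l0.
  case/lexle_prefix_or: (lv') => [[u eu]|k].
    have uv : lexle u v by move: vlv; rewrite {1}eu lexle_catl.
    case: (eqVneq u [::]) => [u0|u0]; first by rewrite eu u0 cats0 lexle_refl.
    have vu : lexle v u by apply: (h (p ++ l)); rewrite ?ew -?catA -?eu.
    have /(congr1 size)/eqP : v = u by apply: lexle_anti; rewrite uv vu.
    by rewrite eu size_cat -[X in _ == X]add0n eqn_add2r size_eq0 (negbTE l0).
  have /(congr1 size)/eqP : v = l ++ v.
    by apply: lexle_anti; rewrite vlv -[X in lexle _ X]cats0 k.
  by rewrite size_cat -[X in X == _]add0n eqn_add2r eq_sym size_eq0 (negbTE l0).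
by rewrite /= lv.
Qed.

(** Multisets over LL of total length n, as sorted lists; b is the total length of the copies of L,
    so that the recursion matches [hcount]. *)
Fixpoint sorted_seqs (LL : seq (seq V)) (n : nat) : seq (seq (seq V)) :=
  if LL is L :: LL' then
    [seq nseq (b %/ size L) L ++ s |
      b <- [seq b <- iota 0 n.+1 | size L %| b], s <- sorted_seqs LL' (n - b)]
  else if n == 0 then [:: [::]] else [::].

Lemma size_sorted_seqs LL n : size (sorted_seqs LL n) = hcount (map size LL) n.
Proof.
elim: LL n => [|L LL IH] n; first by case: n.
rewrite size_allpairs_dep sumnE big_map big_filter.
by apply: eq_bigr => b _.
Qed.

Lemma sorted_seqsP LL n s : sorted lexle LL -> uniq LL -> all (fun l => l != [::]) LL ->
  reflect [/\ sorted lexle s, {subset s <= LL} & size (flatten s) = n]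
    (s \in sorted_seqs LL n).
Proof.
elim: LL n s => [|L LL IH] n s.
  move=> _ _ _ /=; case: eqP => [->|n0]; rewrite ?inE.
    apply: (iffP eqP) => [->|[_ h _]]; first by split.
    by case: s h => // l s /(_ l (mem_head _ _)).
  apply: ReflectF => -[_ h]; case: s h => [_ /esym//|l s /(_ l (mem_head _ _))//].
move=> hs /andP[LN hu] /andP[L0 hne].
have Lmin l : l \in LL -> lexle L l.
  by move=> lL; have /allP := order_path_min (@lexle_trans _ V) hs; apply.
have {}hs := path_sorted hs.
have szL : 0 < size L by rewrite lt0n size_eq0.
apply: (iffP allpairsPdep) => [[b [s' [hb /IH [] // ss' sub sz ->]]]|[ss sub sz]].
  move: hb; rewrite mem_filter mem_iota add0n ltnS /= => /andP[db bn]; split.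
  - rewrite sorted_pairwise ?pairwise_cat; last exact: lexle_trans.
    move: ss'; rewrite (sorted_pairwise (@lexle_trans _ V)) => ->; rewrite andbT; apply/andP; split.
      apply/allrelP => x y; rewrite mem_nseq => /andP[_ /eqP->] /sub; exact: Lmin.
    elim: (_ %/ _) => //= k ->; rewrite andbT; apply/allP => x.
    by rewrite mem_nseq => /andP[_ /eqP->]; apply: lexle_refl.
  - move=> x; rewrite mem_cat mem_nseq inE => /orP[/andP[_ ->//]|/sub->].
    by rewrite orbT.
  - rewrite flatten_cat size_cat sz size_flatten /shape map_nseq sumn_nseq.
    by rewrite mulnC divnK // subnKC.
set q := count_mem L s; set s' := [seq x <- s | x != L].
have Lf : filter (pred1 L) s = nseq q L.
  have /all_pred1P := filter_all (pred1 L) s.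
  by rewrite size_filter.
have es : s = nseq q L ++ s'.
  apply: (sorted_eq (@lexle_trans _ V) (@lexle_anti _ V)) => //; last first.
    by rewrite -Lf perm_sym perm_filterC.
  rewrite sorted_pairwise ?pairwise_cat; last exact: lexle_trans.
  rewrite -!(sorted_pairwise (@lexle_trans _ V)) (sorted_filter (@lexle_trans _ V)) // andbT.
  apply/andP; split.
    apply/allrelP => x y; rewrite mem_nseq mem_filter => /andP[_ /eqP->] /andP[yL /sub].
    by rewrite inE (negbTE yL) => /Lmin.
  by rewrite -Lf; apply: (sorted_filter (@lexle_trans _ V)).
have szs : n = q * size L + size (flatten s').
  by rewrite -sz {1}es flatten_cat size_cat size_flatten /shape map_nseq sumn_nseq mulnC.
exists (q * size L), s'; split; last by rewrite mulnK.
  by rewrite mem_filter dvdn_mull // mem_iota /= add0n ltnS szs leq_addr.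
apply/IH => //; split; first exact: (sorted_filter (@lexle_trans _ V)).
  by move=> x; rewrite mem_filter => /andP[xL /sub]; rewrite inE (negbTE xL).
by rewrite szs addKn.
Qed.

Lemma sorted_seqs_uniq LL n : uniq LL -> all (fun l => l != [::]) LL -> sorted lexle LL ->
  uniq (sorted_seqs LL n).
Proof.
elim: LL n => [|L LL IH] n; first by move=> _ _ _ /=; case: eqP.
move=> /andP[LN hu] /andP[L0 hne] hs; have {}hs := path_sorted hs.
apply: allpairs_uniq_dep.
- by rewrite filter_uniq // iota_uniq.
- by move=> b _; apply: IH.
move=> [b s] [b' s'] /allpairsPdep[b1 [s1 [h1 h2 [e1 e2]]]] /allpairsPdep[b1' [s1' [h1' h2' [e1' e2']]]] /= e.
have cnt c t : t \in sorted_seqs LL (n - c) -> count_mem L t = 0.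
  move=> /sorted_seqsP[] // _ sub _; apply/count_memPn; apply: contra LN; exact: sub.
have eb : b %/ size L = b' %/ size L.
  have := congr1 (count_mem L) e.
  rewrite !count_cat !count_nseq /= eqxx !mul1n e2 e2' (cnt _ _ h2) (cnt _ _ h2').
  by rewrite !addn0.
have {}eb : b = b'.
  move: h1 h1'; rewrite !mem_filter -e1 -e1' => /andP[d _] /andP[d' _].
  by rewrite -(divnK d) eb divnK.
by move: e; rewrite -eb => /eqP; rewrite eqseq_cat // eqxx /= => /eqP->.
Qed.
End Factorization.

Section CountStd.
Variables (disp : Order.disp_t) (V : finOrderType disp) (adj : rel V).
Hypothesis adj_sym : symmetric adj.
Local Notation lexle := (@Defs.lexle disp V).
Local Notation is_std := (@is_std disp V adj).

(** The last factor l is the least, so its first letter is at most the first letter of every factor,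
    which is least in that factor; [std_cat] then applies. *)
Lemma std_flatten (s : seq (seq V)) : sorted lexle s -> all (@lyndon_word disp V) s ->
  all is_std s -> is_std (flatten (rev s)).
Proof.
elim: s => [|l s IH].
  by move=> _ _ _; apply/(is_stdP adj_sym) => -[].
move=> hs /andP[hl hls] /andP[ll lls]; rewrite flatten_rev_cons.
case: l hs hl ll => [|a l]; first by [].
move=> hs hl ll; apply: (std_cat adj_sym) => //; first by apply: IH => //; apply: path_sorted hs.
rewrite all_cat; apply/andP; split; last exact: lyndon_word_min.
apply/allP => x /flattenP[v]; rewrite mem_rev => vs xv.
have /allP/(_ v vs) := order_path_min (@lexle_trans _ V) hs.
case: v vs xv => // b v vs xv /lexle_head ab; apply: (le_trans ab).
have /lyndon_word_min/allP h := allP hls _ vs.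
by move: xv; rewrite inE => /orP[/eqP->//|/h].
Qed.

(** Factors of a standard word are standard, so its Lyndon factors are Lyndon heaps and lie in
    LL. *)
Lemma card_std (W : {set V}) (D n : nat) (LL : seq (seq V)) : n <= D ->
  sorted lexle LL -> uniq LL ->
  (forall l, (l \in LL) = [&& lyndon adj l, all [in W] l & size l <= D]) ->
  #|[set t : n.-tuple V | all [in W] t && is_std t]| = hcount (map size LL) n.
Proof.
move=> nD hs hu hLL.
have LLP l : l \in LL -> [/\ is_std l, @lyndon_word disp V l & all [in W] l].
  by rewrite hLL => /and3P[/(lyndonP adj_sym)[]].
have LL0 : all (fun l => l != [::]) LL by apply/allP => l /LLP[_ /andP[]].
rewrite -size_sorted_seqs cardE -(size_map (@tval n V)) -(size_map (flatten \o rev) (sorted_seqs LL n)).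
apply: perm_size; apply: uniq_perm.
- by rewrite map_inj_uniq ?enum_uniq //; apply: val_inj.
- rewrite map_inj_in_uniq ?sorted_seqs_uniq // => s s' /sorted_seqsP[] // hs1 sub1 _ /sorted_seqsP[] // hs2 sub2 _.
  apply: lyndon_factorization_uniq => //; apply/allP => l.
    by move=> /sub1/LLP[].
  by move=> /sub2/LLP[].
move=> w; apply/mapP/mapP => [[t]|[s /sorted_seqsP[] // ss sub sz ->]].
  rewrite mem_enum inE => /andP[tW ts] ->.
  have [s [ss sl es]] := lyndon_factorization t.
  exists s => //; apply/sorted_seqsP => //; split=> //.
    move=> l lS; have [p [r er]] : exists p r, tval t = p ++ l ++ r.
      rewrite -es; have : l \in rev s by rewrite mem_rev.
      by case/splitPr => p r; exists (flatten p), (flatten r); rewrite flatten_cat.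
    rewrite hLL; apply/and3P; split.
    - apply/(lyndonP adj_sym); split; last exact: (allP sl).
      by move: ts; rewrite er; apply: std_factor.
    - by move: tW; rewrite er !all_cat => /and3P[].
    - apply: leq_trans nD; rewrite -(size_tuple t) er !size_cat.
      by rewrite addnCA leq_addr.
  by rewrite -(size_tuple t) -es /= !size_flatten /shape map_rev sumn_rev.
have szw : size (flatten (rev s)) == n.
  by rewrite -sz !size_flatten /shape map_rev sumn_rev.
exists (Tuple szw) => //; rewrite mem_enum inE /=; apply/andP; split.
  apply/allP => x /flattenP[l]; rewrite mem_rev => /sub/LLP[_ _ /allP]; exact.
apply: std_flatten => //; apply/allP => l /sub/LLP[] //.
Qed.
End CountStd.

(** * The Cartier-Foata identity *)

(** Toggling a fixed element of M reverses the sign. *)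
Lemma sum_subsets_sign (R : numDomainType) (T : finType) (M : {set T}) :
  (\sum_(S : {set T} | S \subset M) (-1) ^+ #|S| = (M == set0)%:R :> R)%R.
Proof.
case: (set_0Vmem M) => [->|[x xM]].
  rewrite eqxx (big_pred1 set0) ?cards0 // => S; by rewrite subset0.
have -> : (M == set0) = false by apply/negbTE/set0Pn; exists x.
pose f (S : {set T}) := if x \in S then S :\ x else x |: S.
have fK : involutive f.
  move=> S; rewrite /f; case: (boolP (x \in S)) => xS; first by rewrite setD11 setD1K.
  by rewrite setU11 setU1K.
set s := (LHS); suff : (s = - s)%R.
  by move/eqP; rewrite -addr_eq0 -mulr2n mulrn_eq0 /= => /eqP.
rewrite {1}/s (reindex_inj (inv_inj fK)) /s -sumrN; apply: eq_big => S.
  rewrite /f; case: ifP => xS; last by rewrite subUset sub1set xM.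
  by rewrite -[in RHS](setD1K xS) subUset sub1set xM.
move=> _; rewrite /f; case: (boolP (x \in S)) => xS.
  by rewrite [in RHS](cardsD1 x) xS exprS mulN1r opprK.
by rewrite cardsU1 xS exprS mulN1r.
Qed.

Section CartierFoata.
Variables (disp : Order.disp_t) (V : finOrderType disp) (adj : rel V).
Hypothesis adj_sym : symmetric adj.
Hypothesis adj_irr : irreflexive adj.
Implicit Types (a b c : V) (p q s u v w h : seq V) (S W : {set V}).
Local Notation heap_eq := (heap_eq adj).
Local Notation is_std := (@is_std disp V adj).
Local Notation free := (free adj).

Definition indep S := [forall u in S, forall v in S, ~~ adj u v].
Definition std_words W n := [set t : n.-tuple V | all [in W] t && is_std t].
Definition indep_sets W k := [set S : {set V} | [&& indep S, S \subset W & #|S| == k]].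

Lemma indepP S : reflect {in S &, forall a b, ~~ adj a b} (indep S).
Proof.
apply: (iffP forallP) => [h a b aS bS|h a].
  by have /implyP/(_ aS)/forallP/(_ b)/implyP/(_ bS) := h a.
by apply/implyP => aS; apply/forallP => b; apply/implyP; apply: h.
Qed.

(** The letters of the minimal pieces; only the first occurrence of a letter can be minimal. *)
Definition bottoms h : {set V} := [set b | (b \in h) && free b (take (index b h) h)].

Lemma bottomsP b h : reflect (exists v, heap_eq h (b :: v)) (b \in bottoms h).
Proof.
rewrite inE; apply: (iffP andP) => [[bh f]|[v]].
  exists (take (index b h) h ++ drop (index b h).+1 h).
  rewrite -{1}(cat_take_drop (index b h) h) (drop_nth b) ?index_mem // nth_index //.
  exact: (@heap_eq_move _ _ _ adj_sym [::]).
case: h => [/heap_eq_size//|x h] e; case: (eqVneq x b) => [->|ne].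
  by rewrite /= eqxx mem_head.
have [u [s [-> f]]] := heap_eq_head e ne.
have bu : b \notin x :: u.
  by apply/negP => /(allP f); rewrite linked_refl.
rewrite -cat_cons mem_cat mem_head orbT index_cat (negbTE bu) /= eqxx addn0.
by rewrite take_size_cat.
Qed.

Lemma bottoms_heap_eq h h' : heap_eq h h' -> bottoms h = bottoms h'.
Proof.
move=> e; apply/setP => b; apply/bottomsP/bottomsP => -[v ev]; exists v.
  by apply: heap_eq_trans ev; rewrite heap_eq_sym.
exact: heap_eq_trans ev.
Qed.

Lemma bottoms_cons b c v : c \in bottoms (b :: v) -> b != c ->
  ~~ adj c b /\ c \in bottoms v.
Proof.
case/bottomsP => v' e ne; have [u [s [-> f]]] := heap_eq_head e ne.
have /andP[] := f; rewrite negb_or => /andP[_ nadj] fu; split=> //.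
by apply/bottomsP; exists (u ++ s); apply: (@heap_eq_move _ _ _ adj_sym [::]).
Qed.

Lemma bottoms_indep h : indep (bottoms h).
Proof.
apply/indepP => b c /bottomsP[v e] hc; case: (eqVneq b c) => [->|ne]; first by rewrite adj_irr.
rewrite adj_sym; move: hc; rewrite (bottoms_heap_eq e) => /bottoms_cons; by case.
Qed.

Lemma bottoms_extract s h : uniq s -> {subset s <= bottoms h} -> exists w, heap_eq h (s ++ w).
Proof.
elim: s h => [|b s IH] h; first by exists h; apply: heap_eq_refl.
move=> /andP[bs us] sub; have /bottomsP[v e] := sub b (mem_head _ _).
have [|w ew] := IH v us.
  move=> c cs; have : c \in bottoms (b :: v).
    by rewrite -(bottoms_heap_eq e); apply: sub; rewrite inE cs orbT.
  by case/bottoms_cons => //; apply: contraNneq bs => ->.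
exists w; apply: heap_eq_trans e _.
exact: (@heap_eq_cat _ _ adj [:: b] [:: b] _ _ (heap_eq_refl _ _)).
Qed.

Lemma bottoms_cat s w : uniq s -> {in s &, forall a b, ~~ adj a b} ->
  {subset s <= bottoms (s ++ w)}.
Proof.
move=> us hs b bS; have := bS; case/splitPr: bS us hs => p q us hs bS.
apply/bottomsP; exists (p ++ q ++ w); rewrite -catA.
apply: (@heap_eq_move _ _ _ adj_sym [::] p); apply/allP => c cp.
rewrite negb_or hs ?andbT //; last by rewrite mem_cat cp.
move: us; rewrite cat_uniq => /and3P[_ /hasPn h _].
by apply: contraTneq (h b (mem_head _ _)) => ->; rewrite negbK.
Qed.

Definition nf w := xchoose (std_exists adj_sym w).
Lemma nf_std w : is_std (nf w). Proof. by have /andP[] := xchooseP (std_exists adj_sym w). Qed.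
Lemma nf_eq w : heap_eq w (nf w). Proof. by have /andP[] := xchooseP (std_exists adj_sym w). Qed.

Lemma heap_eq_all (A : pred V) w w' : heap_eq w w' -> all A w = all A w'.
Proof. by move/heap_eq_perm/perm_all. Qed.

(** Placing the pieces of S below a heap is a bijection onto the heaps having S among their minimal
    pieces; left cancellation gives injectivity. *)
Lemma card_std_bottoms W S n : indep S -> S \subset W -> #|S| <= n ->
  #|[set t in std_words W n | S \subset bottoms t]| = #|std_words W (n - #|S|)|.
Proof.
move=> hi sW leS; set B := [set t in _ | _].
rewrite [LHS]cardE [RHS]cardE -(size_map (@tval n V) (enum B)).
rewrite -(size_map (fun t : (n - #|S|).-tuple V => nf (enum S ++ t)) (enum (std_words W _))).
apply: perm_size; apply: uniq_perm.
- by rewrite map_inj_uniq ?enum_uniq //; apply: val_inj.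
- rewrite map_inj_in_uniq ?enum_uniq // => t t'; rewrite !mem_enum !inE => /andP[_ ht] /andP[_ ht'] e.
  apply: val_inj; apply: (std_uniq adj_sym) => //.
  rewrite -(heap_eq_catl adj (enum S)); apply: heap_eq_trans (nf_eq _) _.
  by rewrite e heap_eq_sym nf_eq.
move=> h; apply/mapP/mapP => -[t].
  rewrite mem_enum !inE -andbA => /and3P[tW ts /subsetP sub] ->.
  have [||w ew] := @bottoms_extract (enum S) t; first exact: enum_uniq.
    by move=> b; rewrite mem_enum => /sub.
  have e : heap_eq t (enum S ++ nf w).
    by apply: heap_eq_trans ew _; rewrite heap_eq_catl nf_eq.
  have sz : size (nf w) == n - #|S|.
    by rewrite -(size_tuple t) (heap_eq_size e) size_cat -cardE addKn.
  exists (Tuple sz); last first.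
    apply: (std_uniq adj_sym) => //; first exact: nf_std.
    exact: heap_eq_trans e (nf_eq _).
  rewrite mem_enum inE /= nf_std andbT.
  by move: tW; rewrite (heap_eq_all _ e) all_cat => /andP[].
rewrite mem_enum inE => /andP[tW ts] ->; set w := enum S ++ t.
have sz : size (nf w) == n.
  by rewrite -(heap_eq_size (nf_eq w)) size_cat -cardE size_tuple subnKC.
exists (Tuple sz) => //; rewrite mem_enum !inE nf_std -(heap_eq_all _ (nf_eq w)) all_cat tW !andbT.
rewrite -(bottoms_heap_eq (nf_eq w)); apply/andP; split.
  by apply/allP => b; rewrite mem_enum => /(subsetP sW).
apply/subsetP => b bS; apply: bottoms_cat; rewrite ?enum_uniq ?mem_enum // => c d.
by rewrite !mem_enum; apply/indepP.
Qed.

(** The left side counts, with sign, the pairs of a heap t and a set S of minimal pieces of t.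
    Summing over S first leaves the heaps without minimal pieces, that is, the empty one. *)
Lemma cartier_foata (R : numDomainType) W n :
  (\sum_(k < n.+1) (-1) ^+ k * #|indep_sets W k|%:R * #|std_words W (n - k)|%:R
    = (n == 0)%:R :> R)%R.
Proof.
transitivity (\sum_(S : {set V} | [&& indep S, S \subset W & (#|S| < n.+1)%N])
    (-1) ^+ #|S| * #|std_words W (n - #|S|)|%:R : R)%R.
  have /(partition_big _ predT) /= -> // : forall S : {set V},
     [&& indep S, S \subset W & (#|S| < n.+1)%N] -> predT (inord #|S| : 'I_n.+1) by [].
  apply: eq_bigr => k _; rewrite mulrAC -[#|indep_sets W k|]sum1_card natr_sum mulr_sumr.
  apply: eq_big => [S|S].
    rewrite inE -!andbA; congr [&& _, _ & _]; apply/eqP/andP => [e|[lt /eqP <-]].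
      by rewrite e ltn_ord inord_val.
    by rewrite inordK.
  by rewrite inE => /and3P[_ _ /eqP->]; rewrite mulr1.
transitivity (\sum_(t in std_words W n) \sum_(S : {set V} | S \subset bottoms t) (-1) ^+ #|S| : R)%R.
  rewrite (exchange_big_dep (fun S : {set V} => [&& indep S, S \subset W & (#|S| < n.+1)%N])) /=.
    apply: eq_bigr => S /and3P[hi hW hn].
    by rewrite -(card_std_bottoms hi hW hn) -sum1_card natr_sum mulr_sumr;
      apply: eq_big => [t|t _]; rewrite ?inE ?mulr1.
  move=> t S; rewrite inE => /andP[tW _] sub.
  have St : {subset S <= t}.
    by move=> b /(subsetP sub); rewrite inE => /andP[].
  apply/and3P; split.
  - apply/indepP => a b /(subsetP sub) hu /(subsetP sub) hv; exact: (indepP _ (bottoms_indep t)).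
  - by apply/subsetP => b /St /(allP tW).
  - rewrite ltnS cardE -(size_tuple t); apply: uniq_leq_size; first exact: enum_uniq.
    by move=> b; rewrite mem_enum => /St.
under eq_bigr do rewrite sum_subsets_sign.
case: n => [|n].
  rewrite (big_pred1 [tuple]); last first.
    move=> t; rewrite (tuple0 t) inE /= eqxx; apply/idP; apply/(is_stdP adj_sym); by case.
  rewrite (_ : bottoms _ = set0) ?eqxx //; apply/setP => b; by rewrite !inE.
apply: big1 => t _; case: eqP => // /setP/(_ (thead t)); rewrite inE.
by case/tupleP: t => x t; rewrite theadE !inE /= eqxx.
Qed.
End CartierFoata.
(** * Power sums and omega *)

Local Open Scope ring_scope.

Definition mon_sub N (a : mon N) (i : 'I_N) (k : nat) : mon N :=
  [ffun j => (a j - (if j == i then k else 0))%N].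

Lemma leq_mdeg N (a : mon N) i : (a i <= mdeg a)%N.
Proof. by rewrite /mdeg (bigD1 i) //= leq_addr. Qed.

Lemma mdeg_sub N (a : mon N) i k : (k <= a i)%N -> mdeg (mon_sub a i k) = (mdeg a - k)%N.
Proof.
move=> h; rewrite /mdeg (bigD1 i) //= [in RHS](bigD1 i) //= ffunE eqxx addnC.
rewrite [in RHS]addnC -addnBA //; congr (_ + _)%N.
by apply: eq_bigr => j ne; rewrite ffunE (negbTE ne) subn0.
Qed.

Lemma psumE k N (c : mon N) : (0 < k)%N ->
  psum k N c = \sum_(i < N) ([forall j, c j == (if j == i then k else 0%N)])%:R.
Proof.
move=> k0; rewrite /psum k0 /=; case: existsP => [[i hi]|h]; last first.
  rewrite big1 // => i _; case: (boolP [forall j, _]) => // hi.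
  by case: h; exists i.
rewrite (bigD1 i) //= hi big1 ?addr0 // => i' ne; case: (boolP [forall j, _]) => // /forallP/(_ i).
by move/forallP/(_ i): hi; rewrite eqxx [i == i']eq_sym (negbTE ne) => /eqP-> /eqP k'; rewrite k' in k0.
Qed.

Lemma smul_psum k F N (a : mon N) : (0 < k)%N ->
  smul (psum k) F N a = \sum_(i < N | (k <= a i)%N) F N (mon_sub a i k).
Proof.
move=> k0; rewrite /smul.
under eq_bigr => b _ do rewrite psumE // mulr_suml.
rewrite exchange_big [RHS]big_mkcond; apply: eq_bigr => i _ /=.
pose bi : {ffun 'I_N -> 'I_(mdeg a).+1} := [ffun j => inord (if j == i then k else 0%N)].
case: ifP => hk; last first.
  apply: big1 => b /forallP hb; case: (boolP [forall j, _]) => [/forallP/(_ i)|_]; last by rewrite mul0r.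
  by rewrite ffunE eqxx => /eqP e; have := hb i; rewrite /= in e *; rewrite e hk.
have vbi j : bi j = (if j == i then k else 0%N) :> nat.
  rewrite ffunE inordK //; case: eqP => // _; rewrite ltnS; exact: leq_trans hk (leq_mdeg _ _).
rewrite (bigD1 bi) /=; last first.
  by apply/forallP => j; rewrite vbi; case: eqP => // ->.
rewrite big1 ?addr0 => [|b /andP[_ ne]]; last first.
  case: (boolP [forall j, _]) => [/forallP e|_]; last by rewrite mul0r.
  case/eqP: ne; apply/ffunP => j; apply: ord_inj; rewrite vbi.
  by have /eqP := e j; rewrite ffunE.
rewrite (_ : [forall j, _] = true) ?mul1r; last first.
  by apply/forallP => j; rewrite ffunE; apply/eqP; apply: vbi.
congr (F N _); apply/ffunP => j; rewrite ffunE [RHS]ffunE; congr (_ - _)%N; exact: vbi.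
Qed.

Lemma eq_smulr F G H N (a : mon N) : (forall c : mon N, G N c = H N c) ->
  smul F G N a = smul F H N a.
Proof. by move=> e; apply: eq_bigr => b _; rewrite e. Qed.

Lemma smul_psumCA k k' F N (a : mon N) : (0 < k)%N -> (0 < k')%N ->
  smul (psum k) (smul (psum k') F) N a = smul (psum k') (smul (psum k) F) N a.
Proof.
move=> k0 k'0; rewrite !smul_psum //.
under eq_bigr => i _ do rewrite smul_psum //.
under [RHS]eq_bigr => i _ do rewrite smul_psum //.
rewrite (exchange_big_dep (fun j => k' <= a j)%N) /=; last first.
  by move=> i j _; rewrite ffunE => /leq_trans; apply; apply: leq_subr.
apply: eq_bigr => j hj; apply: eq_big => [i|i _]; last first.
  by congr (F N _); apply/ffunP => l; rewrite !ffunE subnAC.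
rewrite !ffunE eq_sym; case: eqP => [->|_]; last by rewrite !subn0 hj andbT.
rewrite (leq_subRL _ hj) addnC; case: (leqP k (a j)) => h /=; first by rewrite leq_subRL.
by apply/esym/negbTE; rewrite -ltnNge ltn_addr.
Qed.

Lemma pprod_perm l l' N (a : mon N) : all (leq 1) l -> perm_eq l l' ->
  pprod l N a = pprod l' N a.
Proof.
have mid x s1 s2 : (0 < x)%N -> all (leq 1) s1 -> forall M (c : mon M),
    pprod (s1 ++ x :: s2) M c = pprod (x :: s1 ++ s2) M c.
  move=> x0; elim: s1 => // y s1 IH /andP[y0 /IH {}IH] M c.
  transitivity (smul (psum y) (pprod (x :: s1 ++ s2)) M c); last exact: smul_psumCA.
  by apply: eq_smulr => c'; apply: IH.
move=> hl e; have hl' := hl; rewrite (perm_all _ e) in hl'.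
elim: l l' N a hl hl' e => [|x l IH] l' N a; first by move=> _ _; rewrite perm_sym => /perm_nilP->.
move=> /andP[x0 hl] hl' e; have xl' : x \in l' by rewrite -(perm_mem e) mem_head.
case/splitPr: xl' hl' e => p q; rewrite all_cat => /and3P[hp _ hq] e.
rewrite mid //=; apply: eq_smulr => c; apply: IH => //; first by rewrite all_cat hp.
by move: e; rewrite perm_sym -cat1s perm_catCA /= perm_cons perm_sym.
Qed.

(* As in [Omega], but a list of pairs may repeat a partition, so that sums are concatenations. *)
Definition omega_deg (d : nat) (F G : series) := exists cs : seq (rat * seq nat),
  all (fun p => is_partition p.2 && (sumn p.2 == d)) cs /\
  forall N (a : mon N), mdeg a = d ->
    F N a = \sum_(p <- cs) p.1 * pprod p.2 N a /\
    G N a = \sum_(p <- cs) p.1 * (-1) ^+ (d - size p.2) * pprod p.2 N a.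

Lemma omega_degP F G : (forall d, omega_deg d F G) -> Omega F G.
Proof.
move=> h d; have [cs [hcs e]] := h d.
exists (undup (map snd cs)), (fun l => \sum_(p <- cs | p.2 == l) p.1); split.
  by apply/allP => l; rewrite mem_undup => /mapP[p pc ->]; apply: (allP hcs).
have key (K : seq nat -> rat) : \sum_(p <- cs) p.1 * K p.2 =
    \sum_(l <- undup (map snd cs)) (\sum_(p <- cs | p.2 == l) p.1) * K l.
  under [RHS]eq_bigr => l _ do rewrite mulr_suml.
  rewrite (exchange_big_dep predT) //= [LHS]big_seq [RHS]big_seq; apply: eq_bigr => p pc.
  rewrite (eq_bigl (fun l => l == p.2)); last by move=> l; rewrite eq_sym.
  rewrite -big_filter filter_pred1_uniq ?undup_uniq // ?big_seq1 //.
  by rewrite mem_undup map_f.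
move=> N a ha; have [-> ->] := e N a ha; split; first exact: (key (fun l => pprod l N a)).
under eq_bigr do rewrite -mulrA.
under [RHS]eq_bigr do rewrite -mulrA.
exact: (key (fun l => (-1) ^+ (d - size l) * pprod l N a)).
Qed.

Lemma eq_omega_deg d F G F' G' :
  (forall N (a : mon N), mdeg a = d -> F N a = F' N a /\ G N a = G' N a) ->
  omega_deg d F G -> omega_deg d F' G'.
Proof.
move=> e [cs [hcs h]]; exists cs; split=> // N a ha.
by have [<- <-] := e N a ha; apply: h.
Qed.

Lemma omega_deg_sum d (I : Type) (r : seq I) (c : I -> rat) (F G : I -> series) :
  (forall i, omega_deg d (F i) (G i)) ->
  omega_deg d (fun N a => \sum_(i <- r) c i * F i N a) (fun N a => \sum_(i <- r) c i * G i N a).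
Proof.
move=> h; elim: r => [|i r [cs [hcs e]]].
  by exists [::]; split=> // N a _; rewrite !big_nil.
have [cs' [hcs' e']] := h i.
exists ([seq (c i * p.1, p.2) | p <- cs'] ++ cs); split.
  by rewrite all_cat hcs andbT all_map.
move=> N a ha; have [e1 e2] := e N a ha; have [e1' e2'] := e' N a ha.
rewrite !big_cons !big_cat !big_map /= e1 e2 e1' e2' !mulr_sumr; split; congr (_ + _).
  by apply: eq_bigr => p _; rewrite mulrA.
by apply: eq_bigr => p _; rewrite !mulrA.
Qed.

(** The new part raises the degree by k+1 and the length by 1, whence the sign (-1)^k. *)
Lemma omega_deg_psum d k F G : omega_deg d F G ->
  omega_deg (k.+1 + d) (smul (psum k.+1) F)
    (fun N a => (-1) ^+ k * smul (psum k.+1) G N a).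
Proof.
case=> cs [hcs h]; exists [seq (p.1, sort geq (k.+1 :: p.2)) | p <- cs]; split.
  apply/allP => _ /mapP[p pc ->] /=; have /andP[/andP[sp ap] /eqP sd] := allP hcs p pc.
  rewrite /is_partition sort_sorted => [|x y]; last exact: leq_total.
  by rewrite all_sort /= ap /= (perm_sumn (permEl (perm_sort _ _))) /= sd.
move=> N a ha; rewrite !smul_psum //.
have hm i : (k < a i)%N -> mdeg (mon_sub a i k.+1) = d by move=> hi; rewrite mdeg_sub // ha addKn.
have pp p : p \in cs -> pprod (sort geq (k.+1 :: p.2)) N a = \sum_(i < N | (k < a i)%N) pprod p.2 N (mon_sub a i k.+1).
  move=> pc; rewrite -smul_psum // -[RHS]/(pprod (k.+1 :: p.2) N a).
  have /andP[/andP[_ ap] _] := allP hcs p pc.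
  by apply: pprod_perm; rewrite ?all_sort ?perm_sort //= ap.
have szp p : p \in cs -> (size p.2 <= d)%N.
  move=> pc; have /andP[/andP[_ ap] /eqP <-] := allP hcs p pc.
  by elim: (p.2) ap => //= x l IH /andP[x0 /IH hl]; rewrite -add1n leq_add.
rewrite !big_map; split.
  under [LHS]eq_bigr => i hi do rewrite (proj1 (h _ _ (hm _ hi))).
  rewrite exchange_big big_seq [RHS]big_seq; apply: eq_bigr => p pc /=.
  by rewrite pp // mulr_sumr.
under [X in _ * X = _]eq_bigr => i hi do rewrite (proj2 (h _ _ (hm _ hi))).
rewrite exchange_big mulr_sumr big_seq [RHS]big_seq; apply: eq_bigr => p pc /=.
rewrite pp // size_sort /= addSn subSS -mulr_sumr !mulrA; congr (_ * _).
by rewrite mulrAC -exprD mulrC addnBA ?szp.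
Qed.

Lemma theta_coef (p : {poly rat}) n : ('X * p^`())`_n = n%:R * p`_n.
Proof. by rewrite coefXM; case: n => [|n]; rewrite ?mul0r // coef_deriv /= mulr_natl. Qed.

Lemma eq_coefM (D : nat) (p p' q q' : {poly rat}) :
  (forall n, (n <= D)%N -> p`_n = p'`_n) -> (forall n, (n <= D)%N -> q`_n = q'`_n) ->
  forall n, (n <= D)%N -> (p * q)`_n = (p' * q')`_n.
Proof.
move=> hp hq n nD; rewrite !coefM; apply: eq_bigr => i _.
by rewrite hp ?hq // (leq_trans _ nD) // ?leq_subr // -ltnS.
Qed.

(* The numbers b_k are the coefficients of the logarithmic derivative of \sum_n g_n t^n. *)
Lemma newton_coefficients (f g : nat -> rat) (D : nat) : g 0%N = 1 ->
  (forall n, \sum_(k < n.+1) (-1) ^+ k * f k * g (n - k)%N = (n == 0%N)%:R) ->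
  exists b : nat -> rat, forall n, (n <= D)%N ->
    n%:R * g n = \sum_(k < n) b k * g (n - k.+1)%N /\
    n%:R * f n = \sum_(k < n) (-1) ^+ k * b k * f (n - k.+1)%N.
Proof.
move=> g0 fg.
have [b hb] : exists b : nat -> rat, forall n, (n <= D)%N ->
    n%:R * g n = \sum_(k < n) b k * g (n - k.+1)%N.
  elim: {fg} D => [|D [b hb]].
    by exists (fun=> 0) => n; rewrite leqn0 => /eqP->; rewrite mul0r big_ord0.
  (* As g 0 = 1, the last term of the recurrence at D+1 is b_D itself, so it can be solved for. *)
  pose c := D.+1%:R * g D.+1 - \sum_(k < D) b k * g (D.+1 - k.+1)%N.
  exists (fun k => if k == D then c else b k) => n; rewrite leq_eqVlt => /orP[/eqP->|nD].
    rewrite big_ord_recr /= eqxx subnn g0 mulr1 /c addrC.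
    rewrite -[LHS](subrK (\sum_(k < D) b k * g (D.+1 - k.+1)%N)); congr (_ + _).
    by apply: eq_bigr => k _; rewrite ltn_eqF.
  rewrite hb //; apply: eq_bigr => k _; rewrite ltn_eqF //.
  exact: leq_trans (ltn_ord k) _.
exists b => n nD; split; first exact: hb.
(* Modulo t^(D+1), F is f at -t and F G = 1. With theta = t d/dt, theta G = B G and theta (F G) = 0
   give theta F = - B F; undoing the substitution produces the signs (-1)^k. *)
pose F := \poly_(i < D.+1) ((-1) ^+ i * f i); pose G := \poly_(i < D.+1) g i.
pose B := \poly_(i < D.+1) (if i is k.+1 then b k else 0).
have cF m : (m <= D)%N -> F`_m = (-1) ^+ m * f m by move=> h; rewrite coef_poly ltnS h.
have cG m : (m <= D)%N -> G`_m = g m by move=> h; rewrite coef_poly ltnS h.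
have cBM (P : {poly rat}) m : (m <= D)%N -> (B * P)`_m = \sum_(k < m) b k * P`_(m - k.+1).
  move=> h; rewrite coefM big_ord_recl coef_poly /= mul0r add0r; apply: eq_bigr => k _.
  by rewrite coef_poly /bump add1n ltnS (leq_trans (ltn_ord k)).
have FG m : (m <= D)%N -> (F * G)`_m = (1 : {poly rat})`_m.
  move=> h; rewrite coef1 -fg coefM; apply: eq_bigr => k _.
  by rewrite cF ?cG // (leq_trans _ h) // ?leq_subr // -ltnS.
have GB m : (m <= D)%N -> ('X * G^`())`_m = (B * G)`_m.
  move=> h; rewrite theta_coef cG // hb // cBM //; apply: eq_bigr => k _.
  by rewrite cG // (leq_trans (leq_subr _ _)).
have dFG m : (m <= D)%N -> ('X * F^`() * G)`_m = (- (B * F) * G)`_m.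
  move=> h; apply/eqP; rewrite mulNr coefN -addr_eq0 -coefD.
  have -> : B * F * G = F * (B * G) by rewrite mulrCA mulrA.
  rewrite coefD -(eq_coefM (p := F) (fun _ _ => erefl) GB h) -coefD.
  rewrite (_ : _ + _ = 'X * (F * G)^`()); last first.
    by rewrite derivM mulrDr; congr (_ + _); [rewrite mulrA | rewrite mulrCA].
  by rewrite theta_coef FG // coef1; case: (m) => [|m']; rewrite ?mul0r ?mulr0.
(* G is cancelled by multiplying with F, its inverse modulo t^(D+1). *)
have dF m : (m <= D)%N -> ('X * F^`())`_m = (- (B * F))`_m.
  move=> h; have e : (forall P : {poly rat}, (P * G * F)`_m = P`_m).
    move=> P; rewrite -mulrA [G * F]mulrC (eq_coefM (p' := P) (q' := 1) _ FG h) ?mulr1 //.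
  by rewrite -e -[RHS]e; apply: (eq_coefM dFG).
have := dF n nD; rewrite theta_coef cF // coefN cBM // => e.
have s1 : (-1) ^+ n * (-1) ^+ n = 1 :> rat by rewrite -expr2 sqrr_sign.
have -> : n%:R * f n = (-1) ^+ n * (n%:R * ((-1) ^+ n * f n)).
  by rewrite [RHS]mulrCA; congr (_ * _); rewrite mulrA s1 mul1r.
rewrite e -sumrN mulr_sumr; apply: eq_bigr => k _.
rewrite cF; last by rewrite (leq_trans (leq_subr _ _)).
have -> : (-1) ^+ n = (-1) ^+ k.+1 * (-1) ^+ (n - k.+1) :> rat by rewrite -exprD subnKC.
rewrite exprS mulN1r !mulNr mulrN opprK -!mulrA; congr (_ * _).
rewrite mulrCA; congr (_ * _); rewrite mulrA -expr2 sqrr_sign mul1r //.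
Qed.

(** The product over i of the power series in x_i with coefficients f. *)
Definition prodser (f : nat -> rat) : series := fun N a => \prod_(i < N) f (a i).
Arguments prodser : clear implicits.

Lemma prodser_sub f N (a : mon N) i k :
  prodser f N (mon_sub a i k) = f (a i - k)%N * \prod_(j < N | j != i) f (a j).
Proof.
rewrite /prodser (bigD1 i) //= ffunE eqxx; congr (_ * _).
by apply: eq_bigr => j ne; rewrite ffunE (negbTE ne) subn0.
Qed.

(* Euler's operator, which multiplies x^a by its degree, turns the recurrence for f into
   one for the product, with power sums as coefficients. *)
Lemma prodser_euler f (b : nat -> rat) D :
  (forall n, (n <= D)%N -> n%:R * f n = \sum_(k < n) b k * f (n - k.+1)%N) ->
  forall N (a : mon N), (mdeg a <= D)%N ->
    (mdeg a)%:R * prodser f N a = \sum_(k < D) b k * smul (psum k.+1) (prodser f) N a.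
Proof.
move=> hf N a aD; rewrite [X in X%:R]/mdeg natr_sum mulr_suml.
under [RHS]eq_bigr => k _ do rewrite smul_psum // mulr_sumr big_mkcond.
rewrite [RHS]exchange_big; apply: eq_bigr => i _ /=.
have ai : (a i <= D)%N by apply: leq_trans aD; apply: leq_mdeg.
rewrite -big_mkcond /= [prodser f N a](bigD1 i) //= mulrA hf // mulr_suml.
rewrite (big_ord_widen _ (fun k => b k * f (a i - k.+1)%N * \prod_(j < N | j != i) f (a j)) ai).
by apply: eq_bigr => k _; rewrite prodser_sub mulrA.
Qed.

(** Euler's relation writes the part of degree d as a combination of power sums times parts of lower
    degree. The coefficients for f and g differ by (-1)^k, the sign omega gives to the power sum of
    index k+1. *)
Lemma omega_prodser (f g : nat -> rat) : f 0%N = 1 -> g 0%N = 1 ->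
  (forall n, \sum_(k < n.+1) (-1) ^+ k * f k * g (n - k)%N = (n == 0%N)%:R) ->
  forall d, omega_deg d (prodser f) (prodser g).
Proof.
move=> f0 g0 fg d; have [n] := ubnP d; elim: n d => // n IH d; rewrite ltnS => dn.
case: d dn => [|d] dn.
  exists [:: (1, [::])]; split=> // N a a0.
  have az i : a i = 0%N by apply/eqP; rewrite -leqn0 -a0 leq_mdeg.
  have p1 (h : nat -> rat) : h 0%N = 1 -> prodser h N a = 1.
    by move=> h0; apply: big1 => i _; rewrite az.
  by rewrite !big_seq1 /= !p1 // /sone a0 eqxx !mulr1.
have [b hb] := newton_coefficients d.+1 g0 fg.
apply: (@eq_omega_deg _ (fun N a => \sum_(k < d.+1) ((-1) ^+ k * b k / d.+1%:R) * smul (psum k.+1) (prodser f) N a)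
  (fun N a => \sum_(k < d.+1) ((-1) ^+ k * b k / d.+1%:R) * ((-1) ^+ k * smul (psum k.+1) (prodser g) N a))).
  move=> N a ha; have d0 : d.+1%:R != 0 :> rat by rewrite pnatr_eq0.
  have eul (h c : nat -> rat) : (forall m, (m <= d.+1)%N -> m%:R * h m = \sum_(k < m) c k * h (m - k.+1)%N) ->
      prodser h N a = d.+1%:R^-1 * \sum_(k < d.+1) c k * smul (psum k.+1) (prodser h) N a.
    move=> hh; apply: (mulfI d0); rewrite mulVKf // -{1}ha.
    by apply: prodser_euler; rewrite ?ha.
  rewrite (eul f (fun k => (-1) ^+ k * b k)) => [|m hm]; last by have [] := hb m hm.
  rewrite (eul g b) => [|m hm]; last by have [] := hb m hm.
  rewrite !mulr_sumr; split; apply: eq_bigr => k _; first by rewrite mulrA [d.+1%:R^-1 * _]mulrC.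
  rewrite mulrA [RHS]mulrA; congr (_ * _).
  by rewrite [LHS]mulrC !mulrA -expr2 sqrr_sign mul1r mulrC.
apply: (omega_deg_sum (index_enum _) (fun k : 'I_d.+1 => (-1) ^+ k * b k / d.+1%:R)) => k.
have kd : (k <= d)%N by rewrite -ltnS.
move: (nat_of_ord k) kd => {}k kd.
have -> : d.+1 = (k.+1 + (d - k))%N by rewrite addSn subnKC.
apply: omega_deg_psum; apply: IH.
by apply: leq_trans dn; rewrite ltnS leq_subr.
Qed.

(** * The expansion of products of heap series *)

Lemma hcountE k sigma n D : (n <= D)%N ->
  hcount (k :: sigma) n = (\sum_(b < D.+1 | (b <= n) && (k %| b)) hcount sigma (n - b))%N.
Proof.
move=> nD; rewrite [LHS](_ : _ = \sum_(0 <= b < n.+1 | k %| b) hcount sigma (n - b))%N; last first.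
  by rewrite /index_iota subn0.
rewrite (big_nat_widen _ _ D.+1) ?ltnS // big_mkord.
by apply: eq_bigl => b; rewrite ltnS andbC.
Qed.

Lemma hcount_swap k l sigma n : hcount (k :: l :: sigma) n = hcount (l :: k :: sigma) n.
Proof.
rewrite !(hcountE _ _ (leqnn n)).
under eq_bigr => b _ do rewrite (hcountE _ _ (leq_subr b n)).
under [RHS]eq_bigr => b _ do rewrite (hcountE _ _ (leq_subr b n)).
rewrite (exchange_big_dep (fun c : 'I_n.+1 => (c <= n) && (l %| c)))%N /=; last first.
  by move=> b c _ /andP[h ->]; rewrite andbT (leq_trans h) ?leq_subr.
apply: eq_bigr => c /andP[cn lc]; apply: eq_big => [b|b _]; last by rewrite subnAC.
rewrite lc andbT; case: (k %| b)%N; rewrite ?andbF ?andbT //.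
case: (leqP b n) => bn /=; first by rewrite !leq_subRL // addnC.
by apply/esym/negbTE; rewrite -ltnNge (leq_ltn_trans (leq_subr _ _)).
Qed.

Lemma hcount_perm sigma tau n : perm_eq sigma tau -> hcount sigma n = hcount tau n.
Proof.
have mid x s1 s2 m : hcount (s1 ++ x :: s2) m = hcount (x :: s1 ++ s2) m.
  elim: s1 m => // y s1 IH m; rewrite [RHS]hcount_swap /=.
  by apply: eq_bigr => b _; rewrite IH.
elim: sigma tau n => [|x s IH] t n e; first by move: e; rewrite perm_sym => /perm_nilP->.
have xt : x \in t by rewrite -(perm_mem e) mem_head.
case/splitPr: xt e => p q e; rewrite mid /=; apply: eq_bigr => b _; apply: IH.
by move: e; rewrite perm_sym -cat1s perm_catCA /= perm_cons perm_sym.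
Qed.

(** A new factor 1/(1 - t^k) multiplies the product over the variables by 1 + pbar'_k; the 1 comes
    from taking the multiple 0 of k in every variable. *)
Lemma prodser_hcount_cons k sigma N (a : mon N) :
  prodser (fun n => (hcount (k :: sigma) n)%:R) N a =
  prodser (fun n => (hcount sigma n)%:R) N a +
  smul (pbar1 k) (prodser (fun n => (hcount sigma n)%:R)) N a.
Proof.
rewrite {1}/prodser; under eq_bigr => i _ do
  rewrite (hcountE _ _ (leq_mdeg a i)) big_mkcond natr_sum.
rewrite bigA_distr_bigA /= (bigD1 [ffun=> ord0]) //=; congr (_ + _).
  by apply: eq_bigr => i _; rewrite ffunE /= dvdn0 subn0.
rewrite /smul big_mkcond [RHS]big_mkcond; apply: eq_bigr => b _ /=.
rewrite /pbar1; set c : mon N := [ffun i => val (b i)].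
have -> : (mdeg c != 0%N) = (b != [ffun=> ord0]).
  congr (~~ _); apply/eqP/eqP => [h|eb].
    apply/ffunP => i; apply: ord_inj; rewrite ffunE /=.
    have := leq_mdeg c i; rewrite h leqn0 ffunE => /eqP; exact.
  by rewrite /mdeg big1 // => i _; rewrite ffunE eb ffunE.
case: (boolP (b == _)) => [_|_] /=; first by case: ifP; rewrite ?mul0r.
have -> : [forall i, (k %| c i)%N] = [forall i, (k %| b i)%N].
  by apply: eq_forallb => i; rewrite ffunE.
case: (boolP [forall i, (b i <= a i)%N]) => [/forallP hb|/forallPn[i hi]]; last first.
  by rewrite (bigD1 i) //= (negbTE hi) mul0r.
case: (boolP [forall i, _]) => [/forallP hk|/forallPn[i hi]]; last first.
  by rewrite (bigD1 i) //= (negbTE hi) andbF !mul0r.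
rewrite mul1r; apply: eq_bigr => i _; by rewrite hb hk !ffunE.
Qed.

Lemma smul_sumr (I : Type) (r : seq I) (P : pred I) F (G : I -> series) N (a : mon N) :
  smul F (fun M c => \sum_(i <- r | P i) G i M c) N a = \sum_(i <- r | P i) smul F (G i) N a.
Proof. by rewrite exchange_big; apply: eq_bigr => b _; rewrite mulr_sumr. Qed.

(** In the expanded product of the factors 1 + pbar'_(f x), each x is chosen or not. This is where
    multisets of Lyndon heaps give way to sets of distinct ones. *)
Lemma prodser_hcount_subsets (X : finType) (f : X -> nat) (e : seq X) N (a : mon N) : uniq e ->
  prodser (fun n => (hcount (map f e) n)%:R) N a =
  \sum_(S : {set X} | S \subset e) pbar [seq f x | x <- e & x \in S] N a.
Proof.
elim: e N a => [|x e IH] N a.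
  rewrite (big_pred1 set0) => [_|S]; last first.
    by apply/subsetP/eqP => [h|-> y]; [apply/setP => y; rewrite inE; apply/negP => /h|rewrite inE].
  rewrite /= /sone /prodser; case: eqP => [a0|/eqP a0].
    by apply: big1 => i _; rewrite (_ : a i = 0%N) //; apply/eqP; rewrite -leqn0 -a0 leq_mdeg.
  have [i ai] : exists i, a i != 0%N.
    by apply/existsP; apply: contraR a0; rewrite negb_exists => /forallP h;
      apply/eqP; apply: big1 => i _; have := h i; rewrite negbK => /eqP.
  by rewrite (bigD1 i) //= (negbTE ai) mul0r.
move=> /andP[xe ue]; rewrite [map f _]/= prodser_hcount_cons IH // [RHS](bigID (fun S : {set X} => x \in S)) /= [LHS]addrC.
have subE (S : {set X}) : (S \subset x :: e) && (x \notin S) = (S \subset e).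
  apply/andP/idP => [[/subsetP h xS]|/subsetP h].
    by apply/subsetP => y yS; have := h y yS; rewrite inE; case: eqP yS xS => // -> ->.
  split; first by apply/subsetP => y /h; rewrite inE orbC => ->.
  by apply: contra xe; apply: h.
congr (_ + _).
  transitivity (smul (pbar1 (f x)) (fun M c => \sum_(S : {set X} | S \subset e)
     pbar [seq f x | x <- e & x \in S] M c) N a).
    by apply: eq_smulr => c; apply: IH.
  rewrite smul_sumr [RHS](reindex_onto (fun S : {set X} => x |: S) (fun S => S :\ x)) /=; last first.
    by move=> S /andP[_ xS]; rewrite setD1K.
  apply: eq_big => [S|S hS].
    rewrite setU11 andbT -subE; apply/andP/andP => [[h xS]|[h /eqP <-]].
      rewrite setU1K // eqxx; split=> //; apply/subsetP => y; rewrite inE in_set1.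
      by case/orP => [/eqP->|/(subsetP h)//]; rewrite mem_head.
    rewrite setD11; split=> //; apply: subset_trans h; exact: subD1set.
  rewrite setU11 /=; apply: eq_smulr => c; congr (pbar (map f _) N c).
  apply: eq_in_filter => y ye; rewrite !inE.
  by case: eqP ye xe => // -> ->.
apply: eq_big => [S|S]; first by rewrite subE.
by rewrite -subE => /andP[_ /negbTE ->].
Qed.

Lemma pbar_eq0 l N (a : mon N) : (mdeg a < sumn l)%N -> pbar l N a = 0.
Proof.
elim: l N a => //= k l IH N a h; apply: big1 => b /forallP hb.
rewrite /pbar1; set c : mon N := [ffun i => val (b i)].
case: (boolP (mdeg c != 0%N)) => [c0|_]; last by rewrite mul0r.
case: (boolP [forall i, _]) => [/forallP hk|_]; last by rewrite mul0r.
rewrite mul1r; apply: IH.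
have kc : (k <= mdeg c)%N.
  have [i ci] : exists i, c i != 0%N.
    by apply/existsP; apply: contraR c0; rewrite negb_exists => /forallP h0;
      apply/eqP; apply: big1 => i _; have := h0 i; rewrite negbK => /eqP.
  by apply: leq_trans (leq_mdeg c i); apply: dvdn_leq; rewrite ?lt0n.
have -> : mdeg [ffun i => (a i - b i)%N] = (mdeg a - mdeg c)%N.
  rewrite /mdeg -sumnB => [|i _]; last by rewrite ffunE; apply: hb.
  by apply: eq_bigr => i _; rewrite !ffunE.
have ca : (mdeg c <= mdeg a)%N by apply: leq_sum => i _; rewrite ffunE; apply: hb.
by rewrite ltn_subLR // (leq_trans h) // leq_add2r.
Qed.

Lemma mem_partitions l n : (l \in partitions n) = is_partition l && (sumn l == n).
Proof.
rewrite mem_filter andb_idr // => /andP[/andP[_ lpos] /eqP sl].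
have szl : (size l <= n)%N.
  rewrite -sl; elim: l lpos {sl} => //= x l IH /andP[x0 /IH h].
  by rewrite -add1n leq_add.
have lel x : x \in l -> (x < n.+1)%N.
  by move=> xl; rewrite ltnS -sl (sumnE l) (big_rem x) //= leq_addr.
apply/flattenP; exists [seq map val (tval t) | t : (size l).-tuple 'I_n.+1].
  by apply/mapP; exists (size l) => //; rewrite mem_iota add0n /= ltnS.
have sz : size (map (@inord n) l) == size l by rewrite size_map.
apply/mapP; exists (Tuple sz); first by rewrite mem_enum.
rewrite /= -map_comp map_id_in // => x xl /=.
by rewrite inordK // lel.
Qed.

Lemma partitions_uniq n : uniq (partitions n).
Proof.
rewrite filter_uniq //; apply: (@allpairs_uniq_dep _ _ _ (fun k (t : k.-tuple 'I_n.+1) => map val (tval t)) _ (fun k => enum {: k.-tuple 'I_n.+1})).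
- exact: iota_uniq.
- by move=> k _; apply: enum_uniq.
move=> [k t] [k' t'] _ _ /= e.
have ek : k = k' by move/(congr1 size): e; rewrite !size_map !size_tuple.
move: t' e; rewrite -ek => t' /(inj_map val_inj) e; congr existT; exact: val_inj.
Qed.

Section Fibers.
Variables (X : finType) (f : X -> nat).
Implicit Types (A S : {set X}) (m : nat -> nat) (ks : seq nat).

Definition fiber A k := [set x in A | f x == k].

(** The choices inside different fibers are independent; a subset is split into its part in the
    fiber of k and the rest. *)
Lemma card_subsets_fibers A m ks : uniq ks -> {in A, forall x, f x \in ks} ->
  #|[set S : {set X} | (S \subset A) && all (fun k => #|fiber S k| == m k) ks]| =
  (\prod_(k <- ks) 'C(#|fiber A k|, m k))%N.
Proof.
elim: ks A => [|k ks IH] A.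
  move=> _ h; rewrite big_nil (_ : A = set0); last first.
    by apply/setP => x; rewrite inE; apply/negP => /h.
  rewrite (_ : [set _ | _] = [set set0]) ?cards1 //; apply/setP => S.
  by rewrite !inE subset0 andbT.
move=> /andP[kks uks] h.
have fibD S k' : k' \in ks -> fiber (S :\: fiber A k) k' = fiber S k'.
  move=> k's; apply/setP => x; rewrite !inE; case: (eqVneq (f x) k') => [->|]; rewrite ?andbF //.
  by rewrite (_ : (k' == k) = false) ?andbF ?andbT //; apply: contraNF kks => /eqP <-.
rewrite big_cons (eq_big_seq (fun k' => 'C(#|fiber (A :\: fiber A k) k'|, m k'))) => [|k' k's]; last first.
  by rewrite fibD.
rewrite -(IH (A :\: fiber A k)) => [||x] //; last first.
  by rewrite !inE => /andP[]; case: (boolP (x \in A)) => // xA /=; have := h x xA; rewrite inE; case: eqP.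
rewrite -cards_draws -cardsX.
pose g (S : {set X}) := (S :&: fiber A k, S :\: fiber A k).
have ginj : injective g by move=> S S' [e1 e2]; rewrite -(setID S (fiber A k)) e1 e2 setID.
rewrite -(card_imset _ ginj); apply: eq_card => -[S1 S2]; rewrite [RHS]inE /= !inE.
apply/imsetP/andP => [[S]|[/andP[s1 c1] /andP[s2 c2]]].
  rewrite inE /= => /and3P[sA ck cks] [-> ->]; split.
    rewrite subsetIr /= (_ : S :&: fiber A k = fiber S k) //.
    apply/setP => x; rewrite !inE andbA; congr (_ && _).
    by apply/andb_idr => /(subsetP sA).
  by rewrite setSD //=; apply/allP => k' k's; rewrite fibD // (allP cks).
have d12 : [disjoint S1 & fiber A k :\: fiber A k] by rewrite setDv disjoint_sym disjoints_subset sub0set.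
have s2n x : x \in S2 -> (x \in fiber A k) = false.
  by move/(subsetP s2); rewrite inE => /andP[/negbTE].
have e1 : (S1 :|: S2) :&: fiber A k = S1.
  apply/setP => x; rewrite !in_setI in_setU; case: (boolP (x \in S2)) => [/s2n h2|_].
    by rewrite h2 andbF; apply/esym/negP => /(subsetP s1); rewrite h2.
  by rewrite orbF; apply/andb_idr => /(subsetP s1).
have e2 : (S1 :|: S2) :\: fiber A k = S2.
  apply/setP => x; rewrite in_setD in_setU; case: (boolP (x \in S2)) => [/s2n ->|_]; first by rewrite orbT.
  by rewrite orbF; apply/negbTE; rewrite negb_and negbK; case: (boolP (x \in S1)) => [/(subsetP s1) ->|_]; rewrite ?orbT.
exists (S1 :|: S2); last by rewrite /g e1 e2.
have sU : S1 :|: S2 \subset A.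
  rewrite subUset; apply/andP; split.
    by apply: subset_trans s1 _; apply/subsetP => x; rewrite inE => /andP[].
  by apply: subset_trans s2 _; apply: subsetDl.
rewrite inE sU /=; apply/andP; split.
  rewrite (_ : fiber _ k = S1) // -[RHS]e1; apply/setP => x; rewrite !inE andbA; congr (_ && _).
  by rewrite andb_idr // => hx; apply: (subsetP sU); rewrite inE.
by apply/allP => k' k's; rewrite -fibD // e2 (allP c2).
Qed.

Lemma count_map_filter A (e : seq X) k : uniq e -> e =i A ->
  count_mem k (map f e) = #|fiber A k|.
Proof.
move=> ue eA; rewrite count_map -size_filter cardE.
apply: perm_size; apply: uniq_perm => [||x]; [exact: filter_uniq | exact: enum_uniq |].
by rewrite mem_filter /= mem_enum inE eA andbC.
Qed.

(* Subsets of A are grouped by the partition formed by the values of f on them. *)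
Lemma prodser_hcount_partitions A D N (a : mon N) : (mdeg a <= D)%N ->
  {in A, forall x, (0 < f x <= D)%N} ->
  prodser (fun n => (hcount (map f (enum A)) n)%:R) N a =
  \sum_(n < (mdeg a).+1) \sum_(l <- partitions n)
    (\prod_(1 <= k < D.+1) 'C(#|fiber A k|, count_mem k l))%:R * pbar l N a.
Proof.
(* With A listed by decreasing value, the values on any subset already form a partition. *)
move=> aD hA; pose e := sort (relpre f geq) (enum A).
have ue : uniq e by rewrite sort_uniq enum_uniq.
have eA : e =i A by move=> x; rewrite mem_sort mem_enum.
have pe : perm_eq (map f (enum A)) (map f e) by apply: perm_map; rewrite perm_sym perm_sort.
rewrite [LHS](_ : _ = prodser (fun n => (hcount (map f e) n)%:R) N a); last first.
  by apply: eq_bigr => i _; rewrite (hcount_perm _ pe).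
rewrite prodser_hcount_subsets //.
pose ty (S : {set X}) := [seq f x | x <- e & x \in S].
rewrite (eq_bigl (fun S => S \subset A)) => [|S]; last first.
  by apply/subsetP/subsetP => h x /h; rewrite eA.
have tyP S : S \subset A -> is_partition (ty S).
  move=> sA; apply/andP; split.
    rewrite sorted_map; apply: sorted_filter.
      by move=> x y z /= h1 h2; apply: leq_trans h1.
    by apply: sort_sorted => x y; apply: leq_total.
  apply/allP => _ /mapP[x + ->]; rewrite mem_filter => /andP[xS _].
  by have /andP[] := hA x (subsetP sA _ xS).
have cntty S k : S \subset A -> count_mem k (ty S) = #|fiber S k|.
  move=> sA; apply: count_map_filter; first by rewrite filter_uniq.
  by move=> x; rewrite mem_filter eA andb_idr // => /(subsetP sA).
have tyE S l n : S \subset A -> (n <= D)%N -> l \in partitions n ->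
    all (fun k => #|fiber S k| == count_mem k l) (index_iota 1 D.+1) = (l == ty S).
  move=> sA nD; rewrite mem_partitions => /andP[pl /eqP sl].
  apply/allP/eqP => [h|-> k _]; last by rewrite cntty.
  have geq_trans : transitive geq by move=> x y z h1 h2; apply: leq_trans h1.
  have geq_anti : antisymmetric geq by move=> x y; rewrite -eqn_leq => /eqP.
  have /andP[sl1 pl1] := pl; have /andP[sl2 pl2] := tyP _ sA.
  apply: (sorted_eq geq_trans geq_anti) => //; apply/allP => k _ /=; apply/eqP.
  case: (boolP (k \in index_iota 1 D.+1)) => [/h/eqP <-|]; first by rewrite cntty.
  rewrite mem_index_iota ltnS => kD.
  rewrite (count_memPn _) ?(count_memPn _) //; apply: contra kD.
    move=> /mapP[x + ->]; rewrite mem_filter => /andP[xS _].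
    exact: hA (subsetP sA _ xS).
  move=> kl; rewrite (allP pl1 _ kl) /= (leq_trans _ nD) // -sl.
  by rewrite (sumnE l) (big_rem k) //= leq_addr.
transitivity (\sum_(S : {set X} | S \subset A) \sum_(n < (mdeg a).+1) \sum_(l <- partitions n | l == ty S)
    pbar l N a).
  (* A type of size above the degree of a contributes 0, which agrees with the cut at n <= mdeg
     a. *)
  apply: eq_bigr => S sA; case: (leqP (sumn (ty S)) (mdeg a)) => h; last first.
    rewrite pbar_eq0 // big1 // => n _; apply: big1_seq => l /andP[/eqP-> _].
    exact: pbar_eq0.
  rewrite (bigD1 (Ordinal (h : sumn (ty S) < (mdeg a).+1)%N)) //= [X in _ + X]big1 ?addr0 => [|n ne]; last first.
    apply: big1_seq => l /andP[/eqP->]; rewrite mem_partitions => /andP[_ /eqP en].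
    by case/eqP: ne; apply: val_inj; rewrite /= en.
  rewrite -big_filter filter_pred1_uniq ?partitions_uniq ?big_seq1 //.
  by rewrite mem_partitions tyP /=.
rewrite exchange_big; apply: eq_bigr => n _ /=.
under eq_bigr => S _ do rewrite big_mkcond.
rewrite exchange_big /= !big_seq; apply: eq_bigr => l hl.
rewrite -card_subsets_fibers ?iota_uniq // => [|x xA]; last by rewrite mem_index_iota ltnS hA.
rewrite -sum1_card natr_sum mulr_suml -big_mkcondr /=; apply: eq_big => [S|S _]; last by rewrite mul1r.
rewrite inE; apply/andb_id2l => sA; rewrite (tyE _ _ n) //.
exact: leq_trans (ltn_ord n : n <= mdeg a)%N aD.
Qed.
End Fibers.

(** * Inclusion-exclusion over the used vertices *)

Lemma sum_supsets_sign (R : numDomainType) (T : finType) (U : {set T}) :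
  \sum_(W : {set T} | U \subset W) (-1) ^+ #|~: W| = (U == setT)%:R :> R.
Proof.
rewrite (reindex_inj (inv_inj (@setCK T))) /=.
under eq_bigr do rewrite setCK.
rewrite (eq_bigl (fun W : {set T} => W \subset ~: U)) => [|W]; last by rewrite subsetC.
rewrite sum_subsets_sign; congr (_%:R); congr (nat_of_bool _).
by apply/eqP/eqP => [e|->]; rewrite ?setCT // -(setCK U) e setC0.
Qed.

Section Expansion.
Variables (disp : Order.disp_t) (V : finOrderType disp) (adj : rel V).
Hypothesis adj_sym : symmetric adj.
Hypothesis adj_irr : irreflexive adj.
Local Notation lexle := (@Defs.lexle disp V).

Section Bounded.
Variable D : nat.
Local Notation heaps := {k : 'I_D.+1 & k.-tuple V}.
Implicit Types (W : {set V}) (S : {set heaps}).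

Definition word (x : heaps) : seq V := tagged x.
Definition lyndons W : {set heaps} := [set x | all [in W] (word x) && lyndon adj (word x)].
Definition support S : {set V} := \bigcup_(x in S) [set v in word x].

Lemma size_word x : size (word x) = tag x. Proof. exact: size_tuple. Qed.

Lemma word_inj : injective word.
Proof.
move=> [k t] [k' t'] e; have ek : k = k' by apply: val_inj; rewrite /= -(size_tuple t) -(size_tuple t') [tval t]e.
by move: t' e; rewrite -ek => t' e; congr existT; apply: val_inj.
Qed.

Lemma mem_lyndons_size W : {in lyndons W, forall x : heaps, (0 < tag x <= D)%N}.
Proof.
move=> x; rewrite inE => /andP[_ /(lyndonP adj_sym)[_ /andP[x0 _]]].
by rewrite -size_word lt0n size_eq0 x0 size_word -ltnS ltn_ord.
Qed.

Lemma card_lyndons_fiber W k : (k <= D)%N ->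
  #|fiber (fun x : heaps => tag x : nat) (lyndons W) k| = #|lyndon_set adj W k|.
Proof.
rewrite -ltnS => kD.
pose h (t : k.-tuple V) : heaps := Tagged (fun k : 'I_D.+1 => k.-tuple V) (t : (Ordinal kD).-tuple V).
have hinj : injective h by move=> t t' /(congr1 word) e; apply: val_inj.
rewrite -(card_imset _ hinj); apply: eq_card => x; rewrite !inE.
apply/idP/imsetP => [/andP[hx /eqP ek]|[t + ->]].
  have sz : size (word x) == k by rewrite size_word ek.
  by exists (Tuple sz); [rewrite inE|apply: word_inj].
by rewrite inE => ->; rewrite eqxx.
Qed.

Lemma card_std_words W n : (n <= D)%N ->
  #|std_words adj W n| = hcount (map (fun x : heaps => tag x : nat) (enum (lyndons W))) n.
Proof.
move=> nD; pose LL := sort lexle (map word (enum (lyndons W))).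
rewrite (card_std adj_sym (D := D) (LL := LL) nD) ?sort_uniq ?(map_inj_uniq word_inj) ?enum_uniq //.
- apply: hcount_perm; rewrite (eq_map (fun x => esym (size_word x))) (map_comp size word).
  by apply: perm_map; rewrite perm_sort.
- exact: (sort_sorted (@lexle_total _ V)).
move=> l; rewrite mem_sort; apply/mapP/and3P => [[x + ->]|[ll lW lD]].
  rewrite mem_enum inE => /andP[xW xl]; split=> //.
  by rewrite size_word -ltnS ltn_ord.
exists (Tagged (fun k : 'I_D.+1 => k.-tuple V) (in_tuple l : (Ordinal (lD : size l < D.+1)%N).-tuple V)) => //.
by rewrite mem_enum inE lW ll.
Qed.

Lemma lyndons_support W S : (S \subset lyndons W) = (S \subset lyndons setT) && (support S \subset W).
Proof.
apply/subsetP/andP => [h|[/subsetP hS /bigcupsP hW] x xS].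
  split; first by apply/subsetP => x /h; rewrite !inE => /andP[_ ->]; rewrite andbT; apply/allP.
  apply/bigcupsP => x /h; rewrite inE => /andP[/allP hx _].
  by apply/subsetP => v; rewrite inE => /hx.
have := hS x xS; rewrite !inE => /andP[_ ->]; rewrite andbT.
by apply/allP => v vx; apply: (subsetP (hW x xS)); rewrite inE.
Qed.

Definition typed (lam : seq nat) S :=
  all (fun k => #|fiber (fun x : heaps => tag x : nat) S k| == count_mem k lam) (index_iota 1 D.+1).

(** The binomials count sets S of Lyndon heaps over W of type lam. After exchanging the sums, the
    signed sum over the W containing the support of S vanishes unless that support is all of V. *)
Lemma sum_typed (R : numDomainType) lam :
  \sum_(W : {set V}) (-1) ^+ #|~: W| *
     (\prod_(1 <= k < D.+1) 'C(#|lyndon_set adj W k|, count_mem k lam))%:R =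
  #|[set S : {set heaps} | [&& S \subset lyndons setT, typed lam S & support S == setT]]|%:R :> R.
Proof.
transitivity (\sum_(W : {set V}) \sum_(S : {set heaps} | (S \subset lyndons setT) && typed lam S && (support S \subset W))
    (-1) ^+ #|~: W| : R).
  apply: eq_bigr => W _.
  rewrite (eq_big_nat _ _ (F2 := fun k => 'C(#|fiber (fun x : heaps => tag x : nat) (lyndons W) k|, count_mem k lam))) => [|k /andP[_ kD]]; last first.
    by rewrite card_lyndons_fiber.
  rewrite -card_subsets_fibers ?iota_uniq // => [|x xA]; last by rewrite mem_index_iota ltnS; apply: mem_lyndons_size xA.
  rewrite -[X in _ * X%:R]sum1_card natr_sum mulr_sumr; apply: eq_big => [S|S _]; last by rewrite mulr1.
  by rewrite inE [S \subset lyndons W]lyndons_support andbAC.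
rewrite (exchange_big_dep (fun S => (S \subset lyndons setT) && typed lam S)) /=; last by move=> W S _ /andP[].
rewrite -sum1_card natr_sum [RHS]big_mkcond [LHS]big_mkcond; apply: eq_bigr => S _.
rewrite inE andbA; case: (_ && typed lam S) => //=.
by rewrite sum_supsets_sign; case: eqP.
Qed.

End Bounded.

(** At size 0 both counts vanish, as Lyndon heaps are nonempty and parts are positive. The
    cardinality of S is recovered by summing the counts over all sizes. *)
Lemma heapcount_typed lam : is_partition lam ->
  heapcount adj lam = #|[set S : {set {k : 'I_(sumn lam).+1 & k.-tuple V}} |
    [&& S \subset lyndons _ setT, typed lam S & support S == setT]]|.
Proof.
move=> /andP[_ pos]; rewrite /heapcount; apply: eq_card => S; rewrite !inE.
have fibE (k : 'I_(sumn lam).+1) : [set x in S | tag x == k] = fiber (fun x : {k : 'I_(sumn lam).+1 & k.-tuple V} => tag x : nat) S k.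
  by apply/setP => x; rewrite !inE.
have covE : [forall v : V, [exists x in S, v \in tval (tagged x)]] = (support S == setT).
  apply/forallP/eqP => [h|e v].
    apply/setP => v; rewrite in_setT; have /existsP[x /andP[xS vx]] := h v.
    by apply/bigcupP; exists x; rewrite // inE.
  have : v \in support S by rewrite e.
  by case/bigcupP => x xS; rewrite inE => vx; apply/existsP; exists x; rewrite xS.
have lynE : [forall x in S, lyndon adj (tagged x)] = (S \subset lyndons _ setT).
  apply/forallP/subsetP => h x; have := h x; last first.
    by move=> hx; apply/implyP => /hx; rewrite inE => /andP[].
  move=> /implyP hx /hx hl; rewrite inE /word hl andbT; exact/allP.
rewrite lynE covE; case: (boolP (S \subset _)) => //= sS.
case: (support S == setT); rewrite ?andbF ?andbT //.
apply/andP/idP => [[_ /forallP h]|/allP h].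
  apply/allP => k; rewrite mem_index_iota => /andP[_ kD].
  by have := h (Ordinal kD); rewrite fibE.
have cnt (k : 'I_(sumn lam).+1) : #|[set x in S | tag x == k]| = count_mem (val k) lam.
  rewrite fibE; case: (posnP (val k)) => k0; last by apply/eqP/h; rewrite mem_index_iota k0 ltn_ord.
  rewrite [val k]k0 (count_memPn _); last by apply/negP => /(allP pos).
  apply/eqP; rewrite cards_eq0; apply/eqP/setP => x; rewrite !inE.
  apply/negP => /andP[/(subsetP sS)/mem_lyndons_size + /eqP ek].
  by rewrite ek [nat_of_ord k]k0.
split; last by apply/forallP => k; rewrite cnt.
rewrite -sum1_card (partition_big (fun x => tag x) predT) //=.
under eq_bigr => k _ do rewrite sum1dep_card.
rewrite (eq_bigr (fun k : 'I_(sumn lam).+1 => \sum_(x <- lam) (x == k :> nat)))%N => [|k _]; last first.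
  by rewrite cnt -sumn_count sumnE big_map.
rewrite exchange_big /= -sum1_size big_seq [X in _ == X]big_seq; apply/eqP/eq_bigr => x xl.
have lx : (x < (sumn lam).+1)%N by rewrite ltnS (sumnE lam) (big_rem x) //= leq_addr.
rewrite (bigD1 (Ordinal lx)) //= eqxx big1 // => k ne.
by apply/eqP; rewrite eqb0; apply: contra ne => /eqP e; apply/eqP/val_inj.
Qed.

Lemma heapcount_sum (R : numDomainType) lam : is_partition lam ->
  (heapcount adj lam)%:R = \sum_(W : {set V}) (-1) ^+ #|~: W| *
     (\prod_(1 <= k < (sumn lam).+1) 'C(#|lyndon_set adj W k|, count_mem k lam))%:R :> R.
Proof. by move=> hl; rewrite sum_typed heapcount_typed. Qed.

Lemma heapcount_altsum lam : is_partition lam -> (heapcount adj lam)%:Z = altsum adj lam.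
Proof.
move=> hl; rewrite -natz heapcount_sum //; apply: eq_bigr => W _; congr (_ * _).
by rewrite natr_prod; apply: eq_bigr => k _; rewrite natz.
Qed.

Lemma pbar_expansion_heapcount N (a : mon N) :
  pbar_expansion (fun lam => (heapcount adj lam)%:R) N a =
  \sum_(W : {set V}) (-1) ^+ #|~: W| * prodser (fun n => #|std_words adj W n|%:R) N a.
Proof.
rewrite /pbar_expansion.
transitivity (\sum_(W : {set V}) \sum_(n < (mdeg a).+1) \sum_(l <- partitions n)
   (-1) ^+ #|~: W| * ((\prod_(1 <= k < (mdeg a).+1) 'C(#|lyndon_set adj W k|, count_mem k l))%:R * pbar l N a)).
  rewrite exchange_big; apply: eq_bigr => n _.
  rewrite exchange_big /= big_seq [RHS]big_seq; apply: eq_bigr => l.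
  rewrite mem_partitions => /andP[pl /eqP sl]; rewrite heapcount_sum // mulr_suml.
  apply: eq_bigr => W _; rewrite mulrA; congr (_ * _%:R * _).
  have ln : ((sumn l).+1 <= (mdeg a).+1)%N by rewrite ltnS sl -ltnS ltn_ord.
  (* For k above the size of l the lower index of the binomial is 0, so the range can be extended to
     one common to all l. *)
  rewrite [RHS](big_cat_nat _ ln) //= [X in (_ * X)%N]big1_seq ?muln1 // => k /andP[_].
  rewrite mem_index_iota => /andP[lk _]; rewrite (count_memPn _) ?bin0 //.
  by apply: contraL lk => kl; rewrite -leqNgt (sumnE l) (big_rem k) //= leq_addr.
apply: eq_bigr => W _; under eq_bigr do rewrite -mulr_sumr.
rewrite -mulr_sumr; congr (_ * _); symmetry.
transitivity (prodser (fun n => (hcount (map (fun x : {k : 'I_(mdeg a).+1 & k.-tuple V} => tag x : nat) (enum (lyndons _ W))) n)%:R) N a).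
  by apply: eq_bigr => i _; rewrite (card_std_words _ (leq_mdeg a i)).
rewrite (prodser_hcount_partitions (leqnn _)); last exact: mem_lyndons_size.
apply: eq_bigr => n _; apply: eq_bigr => l _; congr (_%:R * _).
by apply: eq_big_nat => k /andP[_ kD]; rewrite card_lyndons_fiber.
Qed.

(** A set coloring is read through its color classes: independent sets of sizes a i. Nonempty color
    sets mean that the classes cover V, and inclusion-exclusion over W removes this condition. *)
Lemma XG_sum N (a : mon N) :
  XG adj N a =
  \sum_(W : {set V}) (-1) ^+ #|~: W| * prodser (fun k => #|indep_sets adj W k|%:R) N a.
Proof.
pose cls (c : {ffun 'I_N -> {set V}}) := [forall i, c i \in indep_sets adj setT (a i)].
transitivity (\sum_(W : {set V}) \sum_(c : {ffun 'I_N -> {set V}} | cls c && (\bigcup_i c i \subset W))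
    (-1) ^+ #|~: W| : rat); last first.
  apply: eq_bigr => W _; rewrite /prodser.
  under [in RHS]eq_bigr => i _ do rewrite -sum1_card natr_sum big_mkcond.
  rewrite bigA_distr_bigA mulr_sumr /= big_mkcond; apply: eq_bigr => c _.
  have -> : cls c && (\bigcup_i c i \subset W) = [forall i, c i \in indep_sets adj W (a i)].
    apply/andP/forallP => [[/forallP h /bigcupsP hW] i|h].
      by have := h i; rewrite !inE hW // => /and3P[-> _ ->].
    split; last by apply/bigcupsP => i _; have := h i; rewrite inE => /and3P[].
    by apply/forallP => i; have := h i; rewrite !inE subsetT => /and3P[-> _ ->].
  case: (boolP [forall i, _]) => [/forallP h|/forallPn[i /negbTE hi]].
    by rewrite big1 ?mulr1 // => i _; rewrite h.
  by rewrite (bigD1 i) //= hi mul0r mulr0.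
rewrite (exchange_big_dep cls) /=; last by move=> W c _ /andP[].
under eq_bigr => c hc do (under eq_bigl => W do rewrite hc; rewrite sum_supsets_sign).
rewrite /XG -sum1_card natr_sum.
(* The transposition between color classes and color sets, with inverse [h']. *)
pose h (c : {ffun 'I_N -> {set V}}) : {ffun V -> {set 'I_N}} := [ffun v => [set i | v \in c i]].
pose h' (k : {ffun V -> {set 'I_N}}) : {ffun 'I_N -> {set V}} := [ffun i => [set v | i \in k v]].
have hK : cancel h h' by move=> c; apply/ffunP => i; apply/setP => v; rewrite ffunE inE ffunE inE.
have hK' : cancel h' h by move=> c; apply/ffunP => i; apply/setP => v; rewrite ffunE inE ffunE inE.
rewrite (reindex h) /=; last by exists h' => c _.
rewrite big_mkcond [RHS]big_mkcond; apply: eq_bigr => c _.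
rewrite inE.
have -> : proper_set_coloring disp V adj (h c) && [forall i, #|[set v | i \in h c v]| == a i] = cls c && (\bigcup_i c i == setT).
  have cE i : [set v | i \in h c v] = c i by apply/setP => v; rewrite inE ffunE inE.
  have memE i v : (i \in h c v) = (v \in c i) by rewrite ffunE inE.
  apply/idP/idP => [/andP[/andP[/forallP h1 /forallP h2] /forallP h3]|/andP[/forallP h1 /eqP h2]].
    apply/andP; split.
      apply/forallP => i; rewrite inE subsetT /= -{2}(cE i) h3 andbT.
      apply/indepP => u v ui vi; apply/negP => uv.
      have /forallP/(_ v)/implyP/(_ uv)/pred0P/(_ i) := h2 u.
      by rewrite /= !memE ui vi.
    apply/eqP/setP => v; rewrite in_setT; have /set0Pn[i] := h1 v.
    by rewrite memE => vi; apply/bigcupP; exists i.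
  apply/andP; split; last first.
    by apply/forallP => i; rewrite cE; have := h1 i; rewrite inE => /and3P[].
  apply/andP; split; apply/forallP => u.
    have : u \in \bigcup_i c i by rewrite h2.
    by case/bigcupP => i _ ui; apply/set0Pn; exists i; rewrite memE.
  apply/forallP => v; apply/implyP => uv; apply/pred0P => i /=; rewrite !memE.
  apply/negP => /andP[ui vi]; have := h1 i; rewrite inE => /and3P[/indepP hi _ _].
  by have := hi u v ui vi; rewrite uv.
by case: (cls c) => //=; case: eqP.
Qed.

End Expansion.

Theorem theorem1p5 (disp : Order.disp_t) (V : finOrderType disp) (adj : rel V)
    (adj_sym : symmetric adj) (adj_irr : irreflexive adj) :
  Omega (XG adj) (pbar_expansion (fun lam => (heapcount adj lam)%:R)) /\
  (forall lam : seq nat, is_partition lam ->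
     (heapcount adj lam)%:Z = altsum adj lam).
Proof.
split; last exact: heapcount_altsum.
apply: omega_degP => d.
pose I W n : rat := #|indep_sets adj W n|%:R; pose H W n : rat := #|std_words adj W n|%:R.
apply: (@eq_omega_deg _ (fun N a => \sum_(W : {set V}) (-1) ^+ #|~: W| * prodser (I W) N a)
  (fun N a => \sum_(W : {set V}) (-1) ^+ #|~: W| * prodser (H W) N a)) => [N a _|].
  by rewrite XG_sum pbar_expansion_heapcount.
apply: (omega_deg_sum (index_enum _) (fun W : {set V} => (-1) ^+ #|~: W|)) => W.
have CF := cartier_foata adj_sym adj_irr rat W.
(* At n = 0 the Cartier-Foata identity makes a product of two natural numbers 1, so both constant
   terms are 1. *)
have /eqP : #|indep_sets adj W 0|%:R * #|std_words adj W 0|%:R = 1 :> rat.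
  by have := CF 0%N; rewrite big_ord1 mul1r.
rewrite -natrM pnatr_eq1 muln_eq1 => /andP[/eqP I0 /eqP H0].
by apply: omega_prodser; rewrite /I /H ?I0 ?H0.
Qed.
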